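(* Let $r\ge1$, let $a:\mathcal X^r\to\mathbb R$ and $b:\mathcal Y^r\to\mathbb R$ be symmetric kernels with $\mathbb E\{a(X_1,\dots,X_r)^2\}<\infty$ and $\mathbb E\{b(Y_1,\dots,Y_r)^2\}<\infty$, and let $n\ge2r$. Form the arrays $A_I=a(X_I)$ and $B_I=b(Y_I)$, $I\in\mathcal I_{n,r}$. Then $$T^{\mathrm{dir}}_{n,r}=\frac1{d_{n,r}}\langle\mathcal U_{n,r}A,\mathcal U_{n,r}B\rangle=\frac1{d_{n,r}}\langle A,\mathcal U_{n,r}B\rangle=\frac1{d_{n,r}}\langle\mathcal U_{n,r}A,B\rangle.$$ In particular, $$\mathbb E\left[\frac1{d_{n,r}}\langle\mathcal U_{n,r}A,\mathcal U_{n,r}B\rangle\right]=\Theta_r(a,b).$$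
   Context: $O_i=(X_i,Y_i)$, $i\ge1$, are i.i.d. copies of a random pair $(X,Y)$ with values in $\mathcal X\times\mathcal Y$ ($X_i$ and $Y_i$ may be dependent). $[n]=\{1,\dots,n\}$; $\binom{[n]}j$ is the set of $j$-element subsets; $\mathcal I_{n,r}=\binom{[n]}r$; for $I=\{i_1<\dots<i_r\}$, $X_I=(X_{i_1},\dots,X_{i_r})$ and similarly $Y_I$. $\mathcal V_{n,r}=\mathbb R^{\mathcal I_{n,r}}$ with $\langle A,B\rangle=\sum_{I\in\mathcal I_{n,r}}A_IB_I$. U-centering: with $(D_{j,r}A)(J)=\sum_{I\in\mathcal I_{n,r},\,I\supseteq J}A_I$ for $|J|=j$ and $(D_{j,r}^*f)(I)=\sum_{J\subseteq I,\,|J|=j}f(J)$, $$\mathcal U_{n,r}A=\sum_{j=0}^r\frac{(-1)^{r-j}}{\binom{n-r-j+1}{r-j}}D_{j,r}^*D_{j,r}A,\qquad d_{n,r}=\binom nr-\binom n{r-1}.$$ Direct overlap estimator: for $0\le s\le r$ let $N_{n,r,s}=\binom nr\binom rs\binom{n-r}{r-s}$ (the number of ordered pairs $(I,J)\in\mathcal I_{n,r}^2$ with $|I\cap J|=s$), $$\widehat\eta_{n,r,s}=\frac1{N_{n,r,s}}\sum_{I,J\in\mathcal I_{n,r},\,|I\cap J|=s}A_IB_J,\qquad T^{\mathrm{dir}}_{n,r}=\sum_{s=0}^r(-1)^{r-s}\binom rs\widehat\eta_{n,r,s}.$$ Hoeffding components: $g_j(x_1,\dots,x_j)=\mathbb E\{a(x_1,\dots,x_j,X_{j+1},\dots,X_r)\}$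 for $0\le j\le r$ ($g_r=a$), $a_0=g_0$, and recursively $a_j(x_1,\dots,x_j)=g_j(x_1,\dots,x_j)-\sum_{\ell=0}^{j-1}\sum_{S\subseteq[j],|S|=\ell}a_\ell(x_S)$, where $x_S=(x_{s_1},\dots,x_{s_\ell})$ for $S=\{s_1<\dots<s_\ell\}$ and $a_0(x_\varnothing)=a_0$; the components $b_j$ of $b$ are defined analogously using the $Y_i$. The target is $\Theta_r(a,b)=\mathbb E\{a_r(X_1,\dots,X_r)\,b_r(Y_1,\dots,Y_r)\}$. *)

(* Defs.v *)
From mathcomp Require Import all_boot all_order all_algebra all_fingroup.
From mathcomp Require Import all_classical all_reals all_analysis.

Set Implicit Arguments.
Unset Strict Implicit.
Unset Printing Implicit Defensive.

Import Order.TTheory GRing.Theory Num.Theory.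

Local Open Scope ring_scope.

(* The r-element subsets of [n]; everything is 0-based: [n] is 'I_n and the   *)
(* sample O_1, O_2, ... is indexed from 0.                                     *)
Notation ksubset n r := {I : {set 'I_n} | #|I| == r}.

(* k-th smallest element of I: enum lists the elements of a set of ordinals   *)
(* in increasing order (see ltn_subset_elt).                                  *)
Definition subset_elt (n r : nat) (I : ksubset n r) (k : 'I_r) : 'I_n :=
  enum_val (cast_ord (esym (eqP (valP I))) k).

(* x_I = (x_{i_1}, ..., x_{i_r}) for I = {i_1 < ... < i_r} *)
Definition subtuple (T : Type) (n r : nat) (x : 'I_n -> T) (I : ksubset n r) :
    r.-tuple T :=
  [tuple x (subset_elt I k) | k < r].

Lemma subset_elt_in (n r : nat) (I : ksubset n r) (k : 'I_r) :
  subset_elt I k \in val I.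
Proof. exact: enum_valP. Qed.

Lemma ltn_subset_elt (n r : nat) (I : ksubset n r) (k l : 'I_r) :
  (k < l)%N -> (subset_elt I k < subset_elt I l)%N.
Proof.
move=> kl; rewrite /subset_elt /enum_val.
set x0 := enum_default _; set y0 := enum_default _.
have sz : size (enum (val I)) = r by rewrite -cardE; exact/eqP/(valP I).
rewrite (set_nth_default y0) /=; last by rewrite sz.
have srt : sorted ltn (map val (enum (val I))).
  rewrite /enum_mem sorted_map -enumT.
  apply: sorted_filter; first by move=> ? ? ?; exact: ltn_trans.
  by rewrite -sorted_map val_enum_ord; exact: iota_ltn_sorted.
have := sorted_ltn_nth ltn_trans 0%N srt.
move=> /(_ k l); rewrite !inE size_map sz => /(_ (ltn_ord k) (ltn_ord l) kl).
by rewrite !(nth_map y0) ?sz.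
Qed.

Section arrays.
Variable R : realType.

Definition inner (n r : nat) (A B : {ffun ksubset n r -> R}) : R :=
  \sum_(I : ksubset n r) A I * B I.

Definition down (n j r : nat) (A : {ffun ksubset n r -> R}) :
    {ffun ksubset n j -> R} :=
  [ffun J : ksubset n j => \sum_(I : ksubset n r | val J \subset val I) A I].

Definition down_adj (n j r : nat) (f : {ffun ksubset n j -> R}) :
    {ffun ksubset n r -> R} :=
  [ffun I : ksubset n r => \sum_(J : ksubset n j | val J \subset val I) f J].

Definition ucenter (n r : nat) (A : {ffun ksubset n r -> R}) :
    {ffun ksubset n r -> R} :=
  [ffun I : ksubset n r =>
    \sum_(j < r.+1) (-1) ^+ (r - j) / 'C(n - r - j + 1, r - j)%:R
                    * down_adj r (down j A) I].

(* Used for r >= 1 only. *)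
Definition dimU (n r : nat) : R := 'C(n, r)%:R - 'C(n, r - 1)%:R.

Definition npairs (n r s : nat) : nat := ('C(n, r) * 'C(r, s) * 'C(n - r, r - s))%N.

Definition eta_hat (n r s : nat) (A B : {ffun ksubset n r -> R}) : R :=
  (npairs n r s)%:R^-1 *
  \sum_(I : ksubset n r) \sum_(J : ksubset n r | #|val I :&: val J| == s)
     A I * B J.

Definition Tdir (n r : nat) (A B : {ffun ksubset n r -> R}) : R :=
  \sum_(s < r.+1) (-1) ^+ (r - s) * 'C(r, s)%:R * eta_hat s A B.

Definition sym_kernel (T : Type) (r : nat) (a : r.-tuple T -> R) : Prop :=
  forall (s : 'S_r) (x : r.-tuple T), a [tuple tnth x (s k) | k < r] = a x.

Definition kernel_array (T : Type) (n r : nat) (a : r.-tuple T -> R) (x : 'I_n -> T) :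
    {ffun ksubset n r -> R} :=
  [ffun I : ksubset n r => a (subtuple x I)].

End arrays.

Section probability.
Local Open Scope classical_set_scope.
Context (R : realType) (d : measure_display) (Omega : measurableType d)
        (P : probability Omega R).

Definition mutually_independent d' (T : measurableType d')
    (Z : nat -> {RV P >-> T}) : Prop :=
  forall (J : seq nat) (E : nat -> set T), uniq J ->
    (forall i, measurable (E i)) ->
    P (\bigcap_(i in [set` J]) (Z i @^-1` E i)) =
    (\prod_(i <- J) P (Z i @^-1` E i))%E.

Definition iid_copies d' (T : measurableType d') (Z0 : {RV P >-> T})
    (Z : nat -> {RV P >-> T}) : Prop :=
  (forall i (E : set T), measurable E ->
     distribution P (Z i) E = distribution P Z0 E) /\
  mutually_independent Z.

Section hoeffding.
Context (T : Type) (Z : nat -> Omega -> T) (r : nat) (a : r.-tuple T -> R).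

(* g_j(x_1, ..., x_j) = E a(x_1, ..., x_j, Z_{j+1}, ..., Z_r): the default    *)
(* value of nth supplies the coordinates past the length j of x.  Square      *)
(* integrability only makes this integral finite for almost every x; fine     *)
(* yields 0 where it is infinite.                                             *)
Definition hproj (j : nat) (x : j.-tuple T) : R :=
  fine 'E_P[fun w => a [tuple nth (Z k w) x k | k < r]].

(* The recursion of hcompE, run with fuel m >= j. *)
Fixpoint hcomp_rec (m j : nat) : j.-tuple T -> R :=
  match m with
  | 0 => fun x => hproj x
  | m'.+1 => fun x => hproj x -
      \sum_(l < j) \sum_(S : ksubset j l) hcomp_rec m' (subtuple (tnth x) S)
  end.

Definition hcomp (j : nat) (x : j.-tuple T) : R := hcomp_rec j x.

Lemma hcomp_rec_fuel m j (x : j.-tuple T) :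
  (j <= m)%N -> hcomp_rec m x = hcomp x.
Proof.
have gen k : forall m j (x : j.-tuple T), (j <= m)%N -> (j <= k)%N ->
    hcomp_rec m x = hcomp_rec k x.
  elim: k => [|k IH] [|m'] j' x' //=.
  - move=> _; rewrite leqn0 => /eqP j0; subst j'.
    by rewrite big_ord0 subr0.
  - rewrite leqn0 => /eqP j0 _; subst j'.
    by rewrite big_ord0 subr0.
  - move=> jm jk; congr (_ - _); apply: eq_bigr => l _; apply: eq_bigr => S _.
    by apply: IH; rewrite -ltnS; exact: leq_trans (ltn_ord l) _.
by move=> jm; exact: gen.
Qed.

Lemma hcompE (j : nat) (x : j.-tuple T) :
  hcomp x = hproj x -
    \sum_(l < j) \sum_(S : ksubset j l) hcomp (subtuple (tnth x) S).
Proof.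
rewrite -(hcomp_rec_fuel x (leqnSn j)) /=; congr (_ - _).
by apply: eq_bigr => l _; apply: eq_bigr => S _; rewrite hcomp_rec_fuel // ltnW.
Qed.

End hoeffding.

Definition Theta (TX TY : Type) (X : nat -> Omega -> TX) (Y : nat -> Omega -> TY)
    (r : nat) (a : r.-tuple TX -> R) (b : r.-tuple TY -> R) : \bar R :=
  'E_P[fun w => hcomp X a [tuple X i w | i < r] *
                hcomp Y b [tuple Y i w | i < r]].

End probability.

(* Main.v *)
(** The centering [ucenter] has the kernel [ucoef (n - r) r #|I :&: K|], which
    Pascal's rule evaluates to a multiple of (-1)^(r-s) / 'C(n-r, r-s) with
    s = #|I :&: K|; this is exactly the weight that [Tdir] puts on a pair of
    overlap s.  The sum of the kernel over the r-sets containing a given smaller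
    set vanishes, hence <UA, UB> = <UA, B>, and the kernel is symmetric.

    For the expectation, E[A_I B_J] depends only on s = #|I :&: J|; call it
    eta s.  Moebius inversion writes a Hoeffding component as a signed sum of the
    projections g_S over the subsets S of [r], and by Fubini with fresh
    independent copies E[g_S(X_S) g'_S'(Y_S')] = eta #|S :&: S'|.  The signed sum
    over S vanishes unless S' = [r], which leaves
    sum_s (-1)^(r-s) 'C(r, s) eta s, the expectation of [Tdir]. *)
From HB Require Import structures.
Require Import Defs.
From mathcomp Require Import all_boot all_order all_algebra all_fingroup.
From mathcomp Require Import all_classical all_reals all_analysis measurable_realfun.
From mathcomp Require Import ring lra zify.

Set Implicit Arguments.
Unset Strict Implicit.
Unset Printing Implicit Defensive.

Import Order.TTheory GRing.Theory Num.Theory.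

Local Open Scope ring_scope.

(** * Kernel of the U-centering *)

Section ksubsets.
Variables (V : nmodType) (n j : nat).

Lemma sum_ksubset (P : pred {set 'I_n}) (F : {set 'I_n} -> V) :
  \sum_(J : ksubset n j | P (val J)) F (val J) =
  \sum_(J : {set 'I_n} | (#|J| == j) && P J) F J.
Proof. by rewrite (big_sub_cond [pred J : {set 'I_n} | #|J| == j]). Qed.

End ksubsets.

(** The Hoeffding recursion and the centering grade their sums by subset size, while inversion and
    toggling arguments run over all subsets at once. This passes between the two forms. *)
Lemma sum_card (V : nmodType) (n r : nat) (A : {set 'I_n})
    (F : nat -> {set 'I_n} -> V) :
  (#|A| <= r)%N ->
  \sum_(l < r.+1) \sum_(S : ksubset n l | val S \subset A) F l (val S) =
  \sum_(S : {set 'I_n} | S \subset A) F #|S| S.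
Proof.
move=> Ar; under eq_bigr do rewrite (sum_ksubset _ (fun S => S \subset A)).
rewrite [RHS](partition_big (fun S : {set 'I_n} => inord #|S| : 'I_r.+1) predT) //=.
apply: eq_bigr => l _; apply: congr_big => // [S|S /andP[/eqP-> _] //].
rewrite andbC; case: (boolP (S \subset A)) => //= SA.
by rewrite -val_eqE /= inordK // ltnS (leq_trans (subset_leq_card SA)).
Qed.

Section ucoef.
Variable R : realType.

(** Here m stands for n - r, and ['C(s, j)] counts the j-sets contained in both of two index sets of
    overlap s. *)
Definition ucoef (m r s : nat) : R :=
  \sum_(j < r.+1) (-1) ^+ (r - j) / 'C(m - j + 1, r - j)%:R * 'C(s, j)%:R.

Lemma natr_bin_neq0 (m k : nat) : (k <= m)%N -> 'C(m, k)%:R != 0 :> R.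
Proof. by move=> km; rewrite pnatr_eq0 -lt0n bin_gt0. Qed.

(** Pascal's rule splits ['C(s.+1, j.+1)]. In the second half the shift of j is absorbed by lowering
    m and r by one, which leaves both arguments of the denominator binomial unchanged. *)
Lemma ucoefS m r s :
  ucoef m.+1 r.+1 s.+1 = ucoef m.+1 r.+1 s + ucoef m r s.
Proof.
rewrite /ucoef big_ord_recl [X in _ = X + _]big_ord_recl /= !bin0 -addrA.
congr (_ + _); rewrite -big_split; apply: eq_bigr => j _ /=.
by rewrite /bump /= !add1n !subSS binS natrD mulrDr.
Qed.

(** Induction on s along [ucoefS], with m and r general since both drop by one. At s = 0 only the
    term j = 0 is nonzero. *)
Lemma ucoefE m r s : (s <= r <= m)%N ->
  ucoef m r s = (m - r).+1%:R / m.+1%:R * ((-1) ^+ (r - s) / 'C(m, r - s)%:R).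
Proof.
elim: s m r => [|s IH] m r /andP[sr rm].
  rewrite /ucoef big_ord_recl big1 ?addr0 => [|i _]; last by rewrite bin0n mulr0.
  rewrite !subn0 addn1 bin0 mulr1.
  have := mul_bin_down m.+1 r; rewrite /= subSn // => /(congr1 (fun k => k%:R : R)).
  rewrite !natrM => e.
  have h1 := natr_bin_neq0 rm; have h2 := natr_bin_neq0 (leqW rm).
  have h3 : m.+1%:R != 0 :> R by rewrite pnatr_eq0.
  rewrite -[X in _ = X]mulrCA; congr (_ * _).
  apply: (mulfI h2); rewrite mulfV // mulrA mulrA [_ * _%:R]mulrC -e.
  by rewrite mulrAC mulfK // divff.
case: r sr rm => // r sr; case: m => // m rm.
rewrite ucoefS IH; last by lia.
rewrite IH ?subSS ?(subSn (sr : (s <= r)%N)); last by lia.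
have kr : (r - s <= m)%N by rewrite (leq_trans (leq_subr _ _)).
move: (r - s)%N kr => k km.
(* With k = r - s, the binomials ['C(m, k)] and ['C(m.+1, k)] are written as rational multiples of
   ['C(m.+1, k.+1)], so that the claim becomes an identity of rational functions. *)
have := mul_bin_diag m.+1 k; have := mul_bin_left m.+1 k.
move=> /(congr1 (fun k => k%:R : R)) e1 /(congr1 (fun k => k%:R : R)) e2.
rewrite /= !natrM in e1 e2.
have [km'|km'] := eqVneq k m.+1; first by lia.
have h1 : 'C(m, k)%:R != 0 :> R by apply: natr_bin_neq0.
have h2 : 'C(m.+1, k)%:R != 0 :> R by apply: natr_bin_neq0; lia.
have h3 : 'C(m.+1, k.+1)%:R != 0 :> R by apply: natr_bin_neq0; lia.
have k0 : k.+1%:R != 0 :> R by rewrite pnatr_eq0.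
have m0 : m.+1%:R != 0 :> R by rewrite pnatr_eq0.
have m1 : m.+2%:R != 0 :> R by rewrite pnatr_eq0.
have mk0 : (m.+1 - k)%:R != 0 :> R by rewrite pnatr_eq0; lia.
have e3 : (m.+1 - k)%:R = m.+2%:R - k.+1%:R :> R by rewrite -natrB; [congr (_%:R); lia|lia].
have f1 : 'C(m.+1, k)%:R = k.+1%:R * 'C(m.+1, k.+1)%:R / (m.+1 - k)%:R :> R.
  by rewrite e1 mulrAC mulfV // mul1r.
have f2 : 'C(m, k)%:R = k.+1%:R * 'C(m.+1, k.+1)%:R / m.+1%:R :> R.
  by rewrite -e2 mulrAC mulfV // mul1r.
rewrite f1 f2 exprS e3.
have mk0' : m.+2%:R - k.+1%:R != 0 :> R by rewrite -e3.
have n1 i : i.+1%:R = 1 + i%:R :> R by rewrite -(natrD _ 1).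
have n2 i : i.+2%:R = 2 + i%:R :> R by rewrite -(natrD _ 2).
by field; rewrite -!n2 -!n1 mk0' h3 k0 m1 m0.
Qed.

(* This is what makes the kernel sum to zero over the r-sets containing a fixed
   (r-1)-set. *)
Lemma ucoef_rec m r t : (t < r <= m)%N ->
  (r - t)%:R * ucoef m r t.+1 + (m - (r - t).-1)%:R * ucoef m r t = 0.
Proof.
move=> /andP[tr rm].
rewrite !ucoefE; [|lia|lia].
rewrite subnS; have : (0 < r - t <= m)%N by lia.
case: (r - t)%N => // k /= km.
have := mul_bin_left m k => /(congr1 (fun k => k%:R : R)); rewrite !natrM => e.
have h1 : 'C(m, k)%:R != 0 :> R by apply: natr_bin_neq0; lia.
have h2 : 'C(m, k.+1)%:R != 0 :> R by apply: natr_bin_neq0.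
have h3 : (m - k)%:R != 0 :> R by rewrite pnatr_eq0; lia.
have m0 : m.+1%:R != 0 :> R by rewrite pnatr_eq0.
have f : 'C(m, k)%:R = k.+1%:R * 'C(m, k.+1)%:R / (m - k)%:R :> R.
  by rewrite e mulrAC mulfV // mul1r.
rewrite f exprS.
have k0 : k.+1%:R != 0 :> R by rewrite pnatr_eq0.
have n1 i : i.+1%:R = 1 + i%:R :> R by rewrite -(natrD _ 1).
by field; rewrite -!n1 h2 h3 k0 m0.
Qed.

End ucoef.

Section ucenter.
Variables (R : realType) (n r : nat).
Implicit Types A B : {ffun ksubset n r -> R}.

(** After exchanging the sums, [A K] is collected once for each j-set inside [I :&: K]; counting
    these j-sets gives the binomial in [ucoef]. *)
Lemma ucenterE A I : ucenter A I =
  \sum_(K : ksubset n r) ucoef R (n - r) r #|val I :&: val K| * A K.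
Proof.
rewrite ffunE.
under [RHS]eq_bigr do rewrite mulr_suml.
rewrite exchange_big; apply: eq_bigr => j _ /=.
under [RHS]eq_bigr do rewrite -[_ * A _]mulrA.
rewrite -mulr_sumr; congr (_ * _); rewrite ffunE.
under eq_bigr do rewrite ffunE.
rewrite (exchange_big_dep predT) //=; apply: eq_bigr => K _.
rewrite sumr_const -cards_draws mulr_natl; congr (_ *+ _).
rewrite -!sum1_card (sum_ksubset _ (fun J => (J \subset val I) && (J \subset val K)) (fun=> 1%N)).
by apply: eq_bigl => J; rewrite inE finset.subsetI andbC.
Qed.

Lemma inner_ucenterC A B : inner A (ucenter B) = inner (ucenter A) B.
Proof.
rewrite /inner.
under eq_bigr do rewrite ucenterE mulr_sumr.
under [RHS]eq_bigr do rewrite ucenterE mulr_suml.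
rewrite exchange_big; apply: eq_bigr => I _; apply: eq_bigr => K _.
by rewrite finset.setIC mulrCA mulrA.
Qed.

Hypothesis n_ge2r : (2 * r <= n)%N.

(* Downward induction on #|J|; counting the pairs (i, I) with i in I :\: J
   moves the sum from J to its one-point extensions. *)
Lemma sum_ucoef_supset (K J : {set 'I_n}) : #|K| = r -> (#|J| < r)%N ->
  \sum_(I : {set 'I_n} | (#|I| == r) && (J \subset I))
     ucoef R (n - r) r #|I :&: K| = 0.
Proof.
move=> Kr Jr; pose f (I : {set 'I_n}) := ucoef R (n - r) r #|I :&: K|.
pose S (J : {set 'I_n}) := \sum_(I : {set 'I_n} | (#|I| == r) && (J \subset I)) f I.
have SE (J' : {set 'I_n}) : (r - #|J'|)%:R * S J' = \sum_(i | i \notin J') S (i |: J').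
  transitivity (\sum_(I : {set 'I_n} | (#|I| == r) && (J' \subset I))
      \sum_(i | (i \notin J') && (i \in I)) f I).
    rewrite /S mulr_sumr; apply: eq_bigr => I /andP[/eqP Ir JI].
    rewrite sumr_const mulr_natl; congr (_ *+ _).
    rewrite -Ir -cardsDS //.
    by apply: eq_card => i; rewrite !inE.
  rewrite (exchange_big_dep (fun i => i \notin J')) /=; last by move=> I i _ /andP[].
  apply: eq_bigr => i iJ; apply: eq_bigl => I.
  by rewrite iJ /= finset.subUset finset.sub1set -andbA [(i \in I) && _]andbC.
have Sr (J' : {set 'I_n}) : #|J'| = r -> S J' = f J'.
  move=> J'r; rewrite /S (big_pred1 J') // => I.
  apply/andP/eqP => [[/eqP Ir JI]|->]; last by rewrite J'r eqxx subxx.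
  by apply/esym/eqP; rewrite eqEcard JI Ir J'r /=.
have main k : forall J' : {set 'I_n}, (#|J'| + k.+1)%N = r -> S J' = 0.
  elim: k => [|k IH] J' J'k; apply/eqP.
    have rJ : (r - #|J'|)%:R = 1 :> R by rewrite (_ : (r - _)%N = 1%N) //; lia.
    rewrite -[S J']mul1r -rJ SE.
    rewrite (eq_bigr (fun i => f (i |: J'))); last first.
      by move=> i iJ; rewrite Sr // cardsU1 iJ -J'k addnC.
    (* Now [J'] has r - 1 elements. Of its one-point extensions, the r - t by a point of K have
       overlap t + 1 with K, and the remaining ones keep overlap t; these are the two multiplicities
       in [ucoef_rec]. *)
    set t := #|J' :&: K|.
    rewrite (bigID (mem K)) /=.
    rewrite (eq_bigr (fun=> ucoef R (n - r) r t.+1)); last first.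
      move=> i /andP[iJ iK]; rewrite /f finset.setIUl (_ : [set i] :&: K = [set i]).
        by rewrite cardsU1 inE (negPf iJ).
      by apply/finset.setIidPl; rewrite finset.sub1set.
    rewrite [X in _ + X](eq_bigr (fun=> ucoef R (n - r) r t)); last first.
      move=> i /andP[iJ iK]; rewrite /f finset.setIUl (_ : [set i] :&: K = finset.set0).
        by rewrite finset.set0U.
      by apply/setP => k; rewrite !inE; apply: contraNF iK => /andP[/eqP <-].
    rewrite !sumr_const -[X in X + _]mulr_natl -[X in _ + X]mulr_natl.
    have tK : (t <= r)%N by rewrite -Kr subset_leq_card // finset.subsetIr.
    have tJ : (t <= #|J'|)%N by rewrite subset_leq_card // finset.subsetIl.
    have -> : #|[pred i | (i \notin J') && (i \in K)]| = (r - t)%N.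
      rewrite -Kr -[in RHS](cardsID J' K) finset.setIC addKn.
      by apply: eq_card => i; rewrite !inE.
    have -> : #|[pred i | (i \notin J') && (i \notin K)]| = (n - r - (r - t).-1)%N.
      have := cardsC (J' :|: K); have := cardsUI J' K; rewrite card_ord Kr -/t.
      have -> : #|[pred i | (i \notin J') && (i \notin K)]| = #|~: (J' :|: K)|.
        by apply: eq_card => i; rewrite !inE negb_or.
      lia.
    by rewrite ucoef_rec //; lia.
  have rJ : (r - #|J'|)%:R != 0 :> R by rewrite pnatr_eq0; lia.
  rewrite -(inj_eq (mulfI rJ)) SE mulr0 big1 // => i iJ.
  by apply: IH; rewrite cardsU1 iJ; lia.
by apply: (main (r - #|J|.+1)%N); lia.
Qed.

(** This is the vanishing of [down j] on centered arrays for j < r; it kills the lower-order terms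
    of [ucenter B] when paired with [ucenter A]. *)
Lemma sum_ucenter_supset A (J : {set 'I_n}) : (#|J| < r)%N ->
  \sum_(I : ksubset n r | J \subset val I) ucenter A I = 0.
Proof.
move=> Jr; under eq_bigr do rewrite ucenterE.
rewrite exchange_big big1 // => K _; rewrite -mulr_suml.
rewrite (sum_ksubset _ (fun I => J \subset I) (fun I => ucoef R (n - r) r #|I :&: val K|)).
by rewrite sum_ucoef_supset ?mul0r //; apply/eqP/(valP K).
Qed.

(** Expand [ucenter B] by order. The term j = r is the identity, because an r-set inside an r-set
    equals it and the coefficient is 1. For j < r, moving the adjoint across the product produces
    sums of [ucenter A] over the supersets of a j-set, which are zero. *)
Lemma inner_ucenter A B : inner (ucenter A) (ucenter B) = inner (ucenter A) B.
Proof.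
rewrite /inner; under eq_bigr do rewrite [ucenter B _]ffunE mulr_sumr.
rewrite exchange_big big_ord_recr big1 => /= [|j _].
  rewrite add0r subnn bin0 divr1 expr0; apply: eq_bigr => I _.
  rewrite mul1r; congr (_ * _); rewrite ffunE.
  have sub_eq (J K : ksubset n r) : (val J \subset val K) = (J == K).
    apply/idP/eqP => [JK|-> //]; apply/val_inj/eqP.
    by rewrite eqEcard JK (eqP (valP J)) (eqP (valP K)) /=.
  rewrite (big_pred1 I) => [|J]; last exact: sub_eq.
  by rewrite ffunE (big_pred1 I) // => J; rewrite sub_eq eq_sym.
under eq_bigr do rewrite mulrCA.
rewrite -mulr_sumr; apply/eqP; rewrite mulf_eq0; apply/orP; right; apply/eqP.
under eq_bigr do rewrite [down_adj _ _ _]ffunE mulr_sumr.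
rewrite (exchange_big_dep predT) //= big1 // => J _.
by rewrite -mulr_suml sum_ucenter_supset ?mul0r // (eqP (valP J)).
Qed.

(** Factored so that the ratio cancels the prefactor of [ucoefE] at m = n - r. *)
Lemma dimUE : (1 <= r)%N ->
  dimU R n r = 'C(n, r)%:R * ((n - r - r).+1%:R / (n - r).+1%:R).
Proof.
move=> r1; rewrite /dimU.
have := mul_bin_left n r.-1; rewrite prednK // => /(congr1 (fun k => k%:R : R)).
rewrite !natrM subn1 => e.
have m0 : (n - r).+1%:R != 0 :> R by rewrite pnatr_eq0.
have e1 : (n - r.-1)%N = (n - r).+1 by lia.
have e2 : r%:R = (n - r).+1%:R - (n - r - r).+1%:R :> R.
  by rewrite -natrB; [congr (_%:R); lia|lia].
rewrite e1 in e.
have -> : 'C(n, r.-1)%:R = r%:R * 'C(n, r)%:R / (n - r).+1%:R :> R.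
  by rewrite e mulrAC mulfV // mul1r.
rewrite e2; move: (_.+1%:R) m0 => x x0; move: (_.+1%:R) => y.
by field.
Qed.

(** For a pair of overlap s, the factor ['C(r, s)] of [Tdir] cancels against [npairs], and what
    remains is [ucoef] divided by [dimU]. The sums over overlaps then reassemble the sum over all
    pairs. *)
Lemma Tdir_inner A B : (1 <= r)%N ->
  Tdir A B = 1 / dimU R n r * inner A (ucenter B).
Proof.
move=> r1; rewrite /Tdir /eta_hat /inner.
transitivity (\sum_(s < r.+1) \sum_(I : ksubset n r)
    \sum_(J : ksubset n r | #|val I :&: val J| == s)
    (dimU R n r)^-1 * (A I * (ucoef R (n - r) r #|val I :&: val J| * B J))).
  apply: eq_bigr => s _; rewrite mulrA mulr_sumr; apply: eq_bigr => I _.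
  rewrite mulr_sumr; apply: eq_bigr => J /eqP ->.
  rewrite [A I * (_ * _)]mulrCA !mulrA -2![_ * A I * B J]mulrA; congr (_ * _).
  have sr : (s <= r)%N by rewrite -ltnS.
  rewrite ucoefE ?sr /=; last by lia.
  rewrite dimUE // /npairs !natrM.
  have h1 : 'C(n, r)%:R != 0 :> R by apply: natr_bin_neq0; lia.
  have h2 : 'C(n - r, r - s)%:R != 0 :> R by apply: natr_bin_neq0; lia.
  have h3 : 'C(r, s)%:R != 0 :> R by apply: natr_bin_neq0.
  have h4 : (n - r - r).+1%:R != 0 :> R by rewrite pnatr_eq0.
  have h5 : (n - r).+1%:R != 0 :> R by rewrite pnatr_eq0.
  move: ('C(n, r)%:R) ('C(n - r, r - s)%:R) ('C(r, s)%:R) h1 h2 h3 => x y z h1 h2 h3.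
  move: (_.+1%:R) h4 => v h4; move: (_.+1%:R) h5 => w h5.
  by field; rewrite h1 h2 h3 h4 h5.
rewrite exchange_big mulr_sumr; apply: eq_bigr => I _ /=.
rewrite ucenterE mul1r !mulr_sumr.
rewrite [RHS](partition_big (fun J => inord #|val I :&: val J| : 'I_r.+1) predT) //=.
apply: eq_bigr => s _; apply: eq_bigl => J.
rewrite -val_eqE /= inordK // ltnS.
by rewrite (leq_trans (subset_leq_card (finset.subsetIl _ _))) // (eqP (valP I)).
Qed.

End ucenter.

(** * Moebius inversion on subsets *)

Section alternating.
Variables (R : realType) (I : finType).

(** Toggling membership of i is an involution that keeps f and flips the sign, so the sum equals its
    own opposite. *)
Lemma alternating_sum0 (i : I) (f : {set I} -> R) :
  (forall S : {set I}, i \notin S -> f (i |: S) = f S) ->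
  \sum_(S : {set I}) (-1) ^+ #|S| * f S = 0.
Proof.
move=> fi; pose tog (S : {set I}) := if i \in S then S :\ i else i |: S.
have togK : involutive tog.
  move=> S; rewrite /tog; case: (boolP (i \in S)) => iS.
    by rewrite finset.setD11 finset.setD1K.
  by rewrite finset.setU11 finset.setU1K.
have ft (S : {set I}) : (-1) ^+ #|tog S| * f (tog S) = - ((-1) ^+ #|S| * f S).
  rewrite /tog; case: (boolP (i \in S)) => iS; last first.
    by rewrite cardsU1 iS fi // exprS -!mulrA mulN1r.
  have nS : i \notin S :\ i by rewrite finset.setD11.
  by rewrite -[in RHS](finset.setD1K iS) cardsU1 nS fi // exprS -!mulrA mulN1r opprK.
apply/eqP; rewrite -eqNr -sumrN; apply/eqP.
rewrite [RHS](reindex_inj (inv_inj togK)); apply: eq_bigr => S _.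
by rewrite ft.
Qed.

Lemma signr_sub (a b : nat) : (b <= a)%N -> (-1) ^+ (a - b) = (-1) ^+ a * (-1) ^+ b :> R.
Proof.
by move=> ba; rewrite -[in RHS](subnK ba) exprD -mulrA -expr2 sqrr_sign mulr1.
Qed.

(** Both sides equal one signed double sum over chains U, T, S of nested sets. Summing over T first
    leaves only U = S, since otherwise a point of S outside U can be toggled in T; summing over U
    first rebuilds [g T]. *)
Lemma moebius_subset (g h : {set I} -> R) :
  (forall S : {set I}, g S = \sum_(T : {set I} | T \subset S) h T) ->
  forall S : {set I}, h S = \sum_(T : {set I} | T \subset S) (-1) ^+ (#|S| - #|T|) * g T.
Proof.
move=> gh S.
transitivity ((-1) ^+ #|S| * \sum_(U : {set I} | U \subset S)
   h U * \sum_(T : {set I}) (-1) ^+ #|T| * ((U \subset T) && (T \subset S))%:R).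
  rewrite (bigD1 S) //= [X in _ + X]big1 ?addr0; last first.
    move=> U /andP[US neU].
    have : U \proper S by rewrite finset.properEneq neU.
    case/properP => _ [i iS iU].
    rewrite (alternating_sum0 (i := i)) ?mulr0 // => T iT.
    rewrite finset.subUset finset.sub1set iS /=; congr (nat_of_bool (_ && _))%:R.
    apply/idP/idP => [/fintype.subsetP UiT|/fintype.subset_trans-> //]; last exact: finset.subsetUr.
    apply/fintype.subsetP => k kU; have := UiT _ kU; rewrite !inE => /orP[/eqP ki|//].
    by rewrite -ki kU in iU.
  rewrite (bigD1 S) //= subxx mulr1 [X in _ + X]big1 ?addr0.
    by rewrite mulrCA -expr2 sqrr_sign mulr1.
  by move=> T TS; rewrite -finset.eqEsubset eq_sym (negPf TS) mulr0.
rewrite mulr_sumr.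
under eq_bigr do rewrite !mulr_sumr.
rewrite exchange_big [RHS]big_mkcond /=; apply: eq_bigr => T _.
case: ifPn => TS; last by rewrite big1 // => U _; rewrite andbF !mulr0.
rewrite gh signr_sub ?subset_leq_card // mulr_sumr.
rewrite big_mkcond [RHS]big_mkcond /=; apply: eq_bigr => U _.
case: (boolP (U \subset T)) => UT /=.
  by rewrite (fintype.subset_trans UT TS) mulr1 mulrA mulrAC -mulrA mulrC.
by case: ifP; rewrite ?mulr0.
Qed.

End alternating.

(** * Increasing enumerations of subsets *)

Section subset_elt.
Variables (n j : nat).
Implicit Types (S : ksubset n j).

Lemma map_subset_elt S : [seq subset_elt S k | k : 'I_j] = enum (val S).
Proof.
have sz : size (enum (val S)) = j by rewrite -cardE; apply/eqP/(valP S).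
have sz' : size [seq subset_elt S k | k : 'I_j] = j by rewrite size_map size_enum_ord.
(* For j = 0 there may be no element of ['I_n] to serve as the default of [nth]. *)
case: (posnP j) => [j0|j0].
  by rewrite [LHS]size0nil ?[RHS]size0nil ?sz ?sz'.
have x0 := subset_elt S (Ordinal j0).
apply: (@eq_from_nth _ x0) => [|i]; rewrite sz' ?sz // => ij.
rewrite (nth_map (Ordinal ij)) ?size_enum_ord // /subset_elt /enum_val.
rewrite (set_nth_default x0) /=; last by rewrite sz.
by rewrite nth_enum_ord.
Qed.

Lemma subset_elt_inj S : injective (subset_elt S).
Proof.
move=> k k'; rewrite /subset_elt => /enum_val_inj /(congr1 val) /= e.
exact/val_inj.
Qed.

Lemma sorted_enum_ord (A : {set 'I_n}) : sorted ltn (map val (enum A)).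
Proof.
rewrite /enum_mem sorted_map -enumT.
apply: sorted_filter; first by move=> ? ? ?; exact: ltn_trans.
by rewrite -sorted_map val_enum_ord; exact: iota_ltn_sorted.
Qed.

Lemma imset_subset_elt S : subset_elt S @: 'I_j = val S.
Proof.
apply/setP => i; rewrite -[RHS]mem_enum -map_subset_elt.
by apply/imsetP/mapP => -[k _ ->]; exists k; rewrite ?mem_enum.
Qed.

End subset_elt.

(** A composition of increasing enumerations is increasing, and a strictly sorted list is determined
    by its members. Hence taking a subtuple of a subtuple is the same as taking the subtuple at the
    image set. *)
Lemma subset_elt_comp (n j l : nat) (S : ksubset n j) (U : ksubset j l) (V : ksubset n l) :
  val V = subset_elt S @: val U ->
  forall k, subset_elt V k = subset_elt S (subset_elt U k).
Proof.
move=> VE k.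
have e : [seq subset_elt V k | k : 'I_l] = [seq subset_elt S (subset_elt U k) | k : 'I_l].
  apply: (inj_map val_inj).
  apply: (@irr_sorted_eq _ ltn ltn_trans ltnn) => [||i].
  - by rewrite map_subset_elt; exact: sorted_enum_ord.
  - rewrite -map_comp sorted_map.
    have := iota_ltn_sorted 0 l; rewrite -val_enum_ord sorted_map.
    by apply: sub_sorted => k1 k2 /= k12; do 2 apply: ltn_subset_elt.
  - rewrite -[X in _ = (i \in map _ X)]/(map (subset_elt S \o subset_elt U) _).
    have eU : map (subset_elt U) (enum 'I_l) = enum (val U) by exact: map_subset_elt.
    rewrite (map_comp (subset_elt S)) eU map_subset_elt VE.
    apply/mapP/mapP => -[x].
      rewrite mem_enum => /imsetP[y yU ->] ->.
      by exists (subset_elt S y) => //; apply: map_f; rewrite mem_enum.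
    move=> /mapP[y]; rewrite mem_enum => yU -> ->.
    by exists (subset_elt S y) => //; rewrite mem_enum; apply: imset_f.
by move/eq_in_map: e; apply; rewrite mem_enum.
Qed.

(** * Inversion of the Hoeffding recursion *)

Section hoeffding_moebius.
Variables (R : realType) (T : Type) (G H : forall j : nat, j.-tuple T -> R).
Hypothesis HE : forall j (x : j.-tuple T), H x = G x -
  \sum_(l < j) \sum_(S : ksubset j l) H (subtuple (tnth x) S).

(** Reading the length off the set turns a family of functions on tuples of every length into one
    function on subsets, the form that [moebius_subset] takes. *)
Let pack (n : nat) (S : {set 'I_n}) : ksubset n #|S| := exist _ S (eqxx _).
Let onset (F : forall j : nat, j.-tuple T -> R) n (x : 'I_n -> T) (S : {set 'I_n}) :=
  F _ (subtuple x (pack S)).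

Let onsetE F n l (x : 'I_n -> T) (S : ksubset n l) :
  F l (subtuple x S) = onset F x (val S).
Proof.
case: S => S Sl; have /eqP e := Sl; subst l; rewrite /onset /pack /=.
by rewrite (bool_irrelevance Sl (eqxx _)).
Qed.

Let subtuple_full j (x : j.-tuple T) (S : ksubset j j) : subtuple (tnth x) S = x.
Proof.
apply: eq_from_tnth => k; rewrite tnth_mktuple; congr tnth.
have SE : val S = [set: 'I_j].
  by apply/eqP; rewrite finset.eqEcard finset.subsetT cardsT card_ord (eqP (valP S)) /=.
have : map (subset_elt S) (enum 'I_j) = map id (enum 'I_j).
  by rewrite map_id -[LHS]/[seq subset_elt S k | k : 'I_j] map_subset_elt SE enum_setT enumT.
by move/eq_in_map; apply; rewrite mem_enum.
Qed.

(** Moving the subtracted sum of [HE] to the left writes G as the sum of H over all subtuples, the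
    full set contributing H of the tuple itself. Applied to every subtuple of x, this is the
    hypothesis of Moebius inversion. *)
Lemma moebius_subtuple r (x : r.-tuple T) : H x =
  \sum_(l < r.+1) \sum_(S : ksubset r l) (-1) ^+ (r - l) * G (subtuple (tnth x) S).
Proof.
have GE j (y : j.-tuple T) :
    G y = \sum_(l < j.+1) \sum_(S : ksubset j l) H (subtuple (tnth y) S).
  rewrite big_ord_recr /= -[LHS](subrK (\sum_(l < j) \sum_(S : ksubset j l)
    H (subtuple (tnth y) S))) -HE addrC; congr (_ + _).
  have full : #|[set: 'I_j]| == j by rewrite cardsT card_ord.
  rewrite (big_pred1 (exist _ [set: 'I_j] full)) ?subtuple_full // => S.
  rewrite /= -val_eqE /= finset.eqEcard finset.subsetT cardsT card_ord.
  by rewrite (eqP (valP S)) leqnn.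
(* [GE] at the subtuple of S sums over subsets of ['I_#|S|]; the increasing map [e] carries these
   bijectively to the subsets of S, with preimage as inverse. *)
have gh (S : {set 'I_r}) :
    onset G (tnth x) S = \sum_(U : {set 'I_r} | U \subset S) onset H (tnth x) U.
  rewrite [LHS]GE; pose e := subset_elt (pack S).
  transitivity (\sum_(l < #|S|.+1) \sum_(U : ksubset #|S| l | val U \subset [set: 'I_#|S|])
      onset H (tnth x) (e @: val U)).
    apply: eq_bigr => l _; apply: congr_big => // [U|U _]; first by rewrite finset.subsetT.
    have c : #|e @: val U| == l.
      by rewrite card_imset ?(eqP (valP U)) //; apply: subset_elt_inj.
    rewrite -(onsetE H (tnth x) (exist _ (e @: val U) c)); congr H.
    apply: eq_from_tnth => k; rewrite !tnth_mktuple; congr tnth.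
    by rewrite -(subset_elt_comp (V := exist _ (e @: val U) c)).
  rewrite (sum_card (fun _ U => onset H (tnth x) (e @: U))); last first.
    by rewrite cardsT card_ord.
  have ei : injective e by apply: subset_elt_inj.
  rewrite [RHS](reindex_onto (fun U : {set 'I_#|S|} => e @: U) (fun U => e @^-1: U)) /=.
    apply: eq_bigl => U; rewrite finset.subsetT.
    have -> : e @: U \subset S.
      by apply/fintype.subsetP => i /imsetP[k _ ->]; exact: (subset_elt_in (pack S) k).
    by symmetry; apply/eqP/setP => i; rewrite inE mem_imset.
  move=> U US; apply/setP => i; apply/imsetP/idP => [[k]|iU]; first by rewrite inE => ? ->.
  have := fintype.subsetP US _ iU; have eS : e @: 'I_#|S| = S := imset_subset_elt (pack S).
  by rewrite -{1}eS => /imsetP[k _ ik]; exists k; rewrite // inE -ik.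
transitivity (onset H (tnth x) [set: 'I_r]).
  have full : #|[set: 'I_r]| == r by rewrite cardsT card_ord.
  by rewrite -(onsetE H (tnth x) (exist _ [set: 'I_r] full)) subtuple_full.
rewrite (moebius_subset gh).
rewrite -(sum_card (r := r)
  (fun l S => (-1) ^+ (#|[set: 'I_r]| - l) * onset G (tnth x) S)).
  apply: eq_bigr => l _; apply: congr_big => // [S|S _]; first by rewrite finset.subsetT.
  by rewrite cardsT card_ord -onsetE.
by rewrite cardsT card_ord.
Qed.

End hoeffding_moebius.

(** * Counting pairs by overlap *)

Section counting.
Variables (n r : nat).

Lemma card_ksubset : #|{: ksubset n r}| = 'C(n, r).
Proof.
rewrite card_sig -[X in 'C(X, _)]card_ord -card_draws.
by apply: eq_card => I; rewrite !inE.
Qed.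

(** J corresponds to the pair of its traces on I and on the complement of I: an s-set and an (r -
    s)-set, chosen independently. *)
Lemma card_inter (s : nat) (I : {set 'I_n}) : #|I| = r ->
  #|[set J : {set 'I_n} | (#|J| == r) && (#|I :&: J| == s)]| =
  ((s <= r) * ('C(r, s) * 'C(n - r, r - s)))%N.
Proof.
move=> Ir; case: (leqP s r) => sr; last first.
  rewrite mul0n; apply: eq_card0 => J; rewrite !inE; apply/negbTE/negP => /andP[_ /eqP e].
  by have := subset_leq_card (finset.subsetIl I J); rewrite e Ir leqNgt sr.
rewrite mul1n.
have -> : (n - r)%N = #|~: I| by rewrite cardsCs finset.setCK card_ord Ir.
rewrite -[in 'C(r, s)]Ir -!cards_draws -cardsX.
rewrite -(card_in_imset (f := fun KL => KL.1 :|: KL.2)); last first.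
  move=> [K L] [K' L']; rewrite !inE /= => /andP[/andP[KI _] /andP[LI _]].
  move=> /andP[/andP[KI' _] /andP[LI' _]] e.
  have split (M N : {set 'I_n}) : M \subset I -> N \subset ~: I ->
      (M :|: N) :&: I = M /\ (M :|: N) :\: I = N.
    move=> MI NI; split; apply/setP => i; have := fintype.subsetP MI i;
      have := fintype.subsetP NI i; rewrite !inE;
      case: (i \in I) (i \in M) (i \in N) => [] [] [] //=;
      by [move=> /(_ isT)|move=> _ /(_ isT)].
  have [e1 e2] := split _ _ KI LI; have [e1' e2'] := split _ _ KI' LI'.
  by have := congr1 (fun X => (X :&: I, X :\: I)) e; rewrite e1 e2 e1' e2'.
apply: eq_card => J; apply/idP/imsetP => [|[[K L]]]; rewrite !inE /=.
  move=> /andP[/eqP Jr /eqP Js]; exists (J :&: I, J :\: I) => /=; last first.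
    rewrite finset.setUC finset.setDE -finset.setIUr.
    by rewrite [X in _ :&: X]finset.setUC finset.setUCr finset.setIT.
  rewrite !inE /= finset.subsetIr finset.setIC Js eqxx /= finset.setDE finset.subsetIr /=.
  by have := cardsID I J; rewrite finset.setIC Js Jr finset.setDE => e; rewrite -e addKn.
move=> /andP[/andP[KI /eqP Ks] /andP[LI /eqP Ls]] ->.
have IL0 : I :&: L = finset.set0.
  apply/setP => i; have := fintype.subsetP LI i; rewrite !inE.
  by case: (i \in I) (i \in L) => [] [] // /(_ isT).
have KL0 : K :&: L = finset.set0.
  by apply/eqP; rewrite -finset.subset0 -IL0 finset.setSI.
rewrite finset.setIUr (finset.setIidPr KI) IL0 finset.setU0 Ks eqxx andbT.
by rewrite cardsU KL0 cards0 Ks Ls; apply/eqP; lia.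
Qed.

End counting.

Section sums.
Variables (R : realType) (n r : nat) (eta : nat -> R).

(** There are [npairs] equal summands for each overlap, and n >= 2r makes that count positive, so
    the normalization of [eta_hat] cancels. *)
Lemma sum_inter : (2 * r <= n)%N ->
  \sum_(s < r.+1) (-1) ^+ (r - s) * 'C(r, s)%:R * ((npairs n r s)%:R^-1 *
     \sum_(I : ksubset n r) \sum_(J : ksubset n r | #|val I :&: val J| == s) eta s)
  = \sum_(s < r.+1) (-1) ^+ (r - s) * 'C(r, s)%:R * eta s.
Proof.
move=> n2r; apply: eq_bigr => s _; have sr : (s <= r)%N by rewrite -ltnS.
congr (_ * _).
rewrite (eq_bigr (fun=> ('C(r, s) * 'C(n - r, r - s))%:R * eta s)); last first.
  move=> I _; rewrite (sum_ksubset r (fun J => #|val I :&: J| == s) (fun=> eta s)).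
  rewrite sumr_const mulr_natl; congr (_ *+ _).
  rewrite -[RHS]mul1n -[1%N]/(nat_of_bool true) -sr -(card_inter s (eqP (valP I))).
  by apply: eq_card => J; rewrite !inE.
rewrite sumr_const card_ksubset -[_ *+ 'C(n, r)]mulr_natl mulrA -natrM mulnA mulrA.
by rewrite mulVf ?mul1r // pnatr_eq0 -lt0n !muln_gt0 !bin_gt0; lia.
Qed.

(** If S' misses i, toggling i in S does not change [S :&: S'], so the alternating sum over S is
    zero. Only the full S' remains, and the sets S are then grouped by size. *)
Lemma sum_sign_inter :
  \sum_(S : {set 'I_r}) \sum_(S' : {set 'I_r})
     (-1) ^+ (r - #|S|) * ((-1) ^+ (r - #|S'|) * eta #|S :&: S'|) =
  \sum_(s < r.+1) (-1) ^+ (r - s) * 'C(r, s)%:R * eta s.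
Proof.
have cr (S : {set 'I_r}) : (#|S| <= r)%N by rewrite -[leqRHS]card_ord max_card.
rewrite exchange_big (bigD1 [set: 'I_r]) //= [X in _ + X]big1 ?addr0; last first.
  move=> S' S'T; have /subsetPn[i _ iS'] : ~~ ([set: 'I_r] \subset S').
    by rewrite finset.subTset.
  transitivity (\sum_(S : {set 'I_r}) ((-1) ^+ r * (-1) ^+ (r - #|S'|)) *
      ((-1) ^+ #|S| * eta #|S :&: S'|)).
    by apply: eq_bigr => S _; rewrite (signr_sub _ (cr S)); ring.
  rewrite -mulr_sumr (alternating_sum0 (i := i)) ?mulr0 // => S iS.
  congr eta; apply: eq_card => k; rewrite !inE.
  by case: eqP => [->|//]; rewrite (negPf iS') !andbF.
under eq_bigr do rewrite finset.setIT cardsT card_ord subnn mul1r.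
transitivity (\sum_(S : {set 'I_r} | S \subset [set: 'I_r]) (-1) ^+ (r - #|S|) * eta #|S|).
  by apply: eq_bigl => S; rewrite finset.subsetT.
rewrite -(sum_card (r := r) (fun l S => (-1) ^+ (r - l) * eta l)) // .
apply: eq_bigr => l _; rewrite (eq_bigl predT) => [|S]; last by rewrite finset.subsetT.
by rewrite sumr_const card_ksubset mulrAC mulr_natr.
Qed.

End sums.

Local Open Scope classical_set_scope.
Local Open Scope ring_scope.

(** * Laws of tuples and conditional means *)

Section box.
Context d (T : measurableType d) (m : nat).

Definition box (E : 'I_m -> set T) : set (m.-tuple T) :=
  [set x | forall k, E k (tnth x k)].

Definition boxes : set (set (m.-tuple T)) :=
  [set B | exists2 E, (forall k, measurable (E k)) & B = box E].

Lemma measurable_box E : (forall k, measurable (E k)) -> measurable (box E).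
Proof.
move=> mE; have -> : box E = \big[setI/setT]_(k < m) ((fun x => tnth x k) @^-1` E k).
  rewrite -bigcap_seq; apply/seteqP; split=> [x Ex k _|x Ex k]; first exact: Ex.
  by apply: Ex; rewrite /= mem_index_enum.
apply: bigsetI_measurable => k _; rewrite -[X in measurable X]setTI.
exact: measurable_tnth.
Qed.

Lemma measurable_tuple_boxes : measurable = <<s boxes >>.
Proof.
rewrite eqEsubset; split; last first.
  apply: smallest_sub; first exact: sigma_algebra_measurable.
  by move=> _ [E mE ->]; exact: measurable_box.
apply: smallest_sub; first exact: smallest_sigma_algebra.
move=> B; rewrite -bigcup_seq => -[k _ [A mA <-]].
(* A generator of the tuple sigma-algebra constrains one coordinate, so it is a box whose other
   sides are full. *)
apply: sub_sigma_algebra; exists (fun i => if i == k then A else setT).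
  by move=> i; case: ifP.
apply/seteqP; split=> [x [_ Ax] i|x /(_ k)]; last by rewrite eqxx.
by case: eqP => // ->.
Qed.

Lemma boxes_setI_closed : setI_closed boxes.
Proof.
move=> _ _ [E mE ->] [F mF ->]; exists (fun k => E k `&` F k).
  by move=> k; exact: measurableI.
by apply/seteqP; split=> [x [Ex Fx] k|x EF]; split=> // k; case: (EF k).
Qed.

(** Boxes are closed under intersection, generate the sigma-algebra and include the whole space, so
    uniqueness of measures applies with a constant exhausting sequence. *)
Lemma eq_probability_boxes (R : realType) (m1 m2 : probability (m.-tuple T) R) :
  (forall E, (forall k, measurable (E k)) -> m1 (box E) = m2 (box E)) ->
  forall B, measurable B -> m1 B = m2 B.
Proof.
move=> m12; apply: (measure_unique boxes (fun=> setT)) => //.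
- exact: measurable_tuple_boxes.
- exact: boxes_setI_closed.
- by move=> _; exists (fun=> setT) => //; apply/seteqP.
- exact: bigcup_const.
- by move=> _ [E mE ->]; exact: m12.
- by move=> _; rewrite /= probability_setT ltry.
Qed.

End box.

Lemma integral_distributionT (R : realType) d (Omega : measurableType d)
    (P : probability Omega R) d1 (T1 : measurableType d1) (U : {RV P >-> T1}) (f : T1 -> \bar R) :
  measurable_fun setT f ->
  (\int[distribution P U]_x f x = \int[P]_w f (U w))%E.
Proof.
move=> mf; rewrite integralE [RHS]integralE.
rewrite !ge0_integral_distribution //.
- by rewrite -(funepos_comp f U) -(funeneg_comp f U).
- exact: measurable_funeneg.
- exact: measurable_funepos.
Qed.

(** * Independent pairs and conditional means *)

Section pair_law.
Context (R : realType) d (Omega : measurableType d) (P : probability Omega R).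
Context d1 (T1 : measurableType d1) d2 (T2 : measurableType d2).

Variables (U : {RV P >-> T1}) (V : {RV P >-> T2}).

Definition pairRV (w : Omega) := (U w, V w).

Lemma measurable_pairRV : measurable_fun setT pairRV.
Proof. exact: measurable_fun_pair. Qed.

HB.instance Definition _ := isMeasurableFun.Build _ _ _ _ pairRV measurable_pairRV.

Definition product_law : Prop := forall A : set (T1 * T2), measurable A ->
  distribution P pairRV A = (distribution P U \x distribution P V)%E A.

Hypothesis UV : product_law.

(** For independent U and V this is a version of the conditional expectation of h given U = u. As in
    [hproj], an infinite integral is replaced by 0. *)
Definition cond_mean (h : T1 * T2 -> R) (u : T1) : R := fine 'E_P[fun w => h (u, V w)].

Lemma cond_meanE h u : measurable_fun setT h ->
  cond_mean h u = fine (\int[distribution P V]_v (h (u, v))%:E)%E.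
Proof.
move=> mh; rewrite /cond_mean unlock integral_distributionT //.
apply/measurable_EFinP; exact: measurableT_comp.
Qed.

(** Since [h (u, _)] may fail to be integrable at some u, Tonelli is applied to the positive and
    negative parts separately. *)
Lemma measurable_cond_mean h : measurable_fun setT h -> measurable_fun setT (cond_mean h).
Proof.
move=> mh; rewrite (_ : cond_mean h = fine \o (fun u =>
    (\int[distribution P V]_v ((EFin \o h)^\+ (u, v)) -
     \int[distribution P V]_v ((EFin \o h)^\- (u, v)))%E)).
  apply: measurableT_comp => //; apply: emeasurable_funB.
    apply: measurable_fun_fubini_tonelli_F => //.
    by apply: measurable_funepos; apply/measurable_EFinP.
  apply: measurable_fun_fubini_tonelli_F => //.
  by apply: measurable_funeneg; apply/measurable_EFinP.
apply/funext => u; rewrite cond_meanE // /= integralE.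
under eq_integral do rewrite (funepos_comp (EFin \o h) (fun v => (u, v))).
by under [X in (_ - X)%E]eq_integral do rewrite (funeneg_comp (EFin \o h) (fun v => (u, v))).
Qed.

(** Fubini for the product f h under the product law. Integrability is known for this product, not
    for h. *)
Lemma integral_cond_mean (f : T1 -> R) (h : T1 * T2 -> R) :
  measurable_fun setT f -> measurable_fun setT h ->
  P.-integrable setT (fun w => (f (U w) * h (U w, V w))%:E) ->
  P.-integrable setT (fun w => (f (U w) * cond_mean h (U w))%:E) /\
  (\int[P]_w (f (U w) * cond_mean h (U w))%:E = \int[P]_w (f (U w) * h (U w, V w))%:E)%E.
Proof.
move=> mf mh ifh; pose F z := (f z.1 * h z)%:E.
have mF : measurable_fun setT F.
  by apply/measurable_EFinP; apply: measurable_funM => //; exact: measurableT_comp.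
have mc := measurable_cond_mean mh.
have iF : ((distribution P U \x distribution P V)%E).-integrable setT F.
  apply/integrableP; split=> //.
  rewrite (eq_measure_integral (distribution P pairRV)); last by move=> A mA _; exact/esym/UV.
  rewrite integral_distributionT; last exact: measurableT_comp.
  by case/integrableP: ifh.
have aeF : ae_eq (distribution P U) setT (fun u => (f u * cond_mean h u)%:E)
   (fun u => \int[distribution P V]_v F (u, v))%E.
  have := ae_integrable1 iF; apply: filterS => u iu _.
  rewrite cond_meanE //.
  (* Where f vanishes both sides are 0; elsewhere dividing by [f u] makes the section of h
     integrable, so that [fine] loses nothing. *)
  have [f0|f0] := eqVneq (f u) 0.
    rewrite f0 mul0r; apply/esym.
    by under eq_integral do rewrite /F /= f0 mul0r; rewrite integral0.
  have ih : (distribution P V).-integrable setT (fun v => (h (u, v))%:E).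
    have := integrableZl measurableT (f u)^-1 iu.
    apply: eq_integrable => // v _.
    by rewrite /F /= -EFinM mulrA mulVf // mul1r.
  rewrite EFinM fineK; last exact: integrable_fin_num.
  by rewrite -integralZl.
have mfc : measurable_fun setT (fun u => (f u * cond_mean h u)%:E).
  by apply/measurable_EFinP; exact: measurable_funM.
have iG : (distribution P U).-integrable setT (fun u => (f u * cond_mean h u)%:E).
  have /integrableP[mG iG] := integrable_fubini_F iF.
  apply/integrableP; split=> //; apply: le_lt_trans iG; rewrite le_eqVlt; apply/orP; left.
  apply/eqP; apply: ae_eq_integral => //; [exact: measurableT_comp|exact: measurableT_comp|].
  by apply: filterS aeF => u fu _; congr (`|_|)%E; exact: fu.
split.
  apply/integrableP; split.
    exact: (measurableT_comp mfc).
  rewrite -(@integral_distributionT _ _ _ _ _ _ U (fun u => `|(f u * cond_mean h u)%:E|)%E).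
    by case/integrableP: iG.
  exact: measurableT_comp.
rewrite -(@integral_distributionT _ _ _ _ _ _ U (fun u => (f u * cond_mean h u)%:E)) //.
rewrite (ae_eq_integral (fun u => \int[distribution P V]_v F (u, v))%E) //; last first.
  exact: measurable_fubini_F iF.
rewrite -[RHS]/(\int[P]_w F (pairRV w))%E -integral_distributionT //.
rewrite (eq_measure_integral (distribution P U \x distribution P V)%E); last first.
  by move=> A mA _; exact: UV.
by rewrite -integral12_prod_meas1.
Qed.

End pair_law.

Definition reindex_tuple (T : Type) m n (s : 'I_n -> 'I_m) (z : m.-tuple T) : n.-tuple T :=
  [tuple tnth z (s k) | k < n].

Section cat_tuple.
Context d (T : measurableType d) (m p : nat).

Definition cat_pair (z : m.-tuple T * p.-tuple T) : (m + p).-tuple T := cat_tuple z.1 z.2.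

Lemma measurable_cat_pair : measurable_fun setT cat_pair.
Proof.
apply/measurable_fun_tnthP => i; rewrite -[i]splitK; case: (fintype.split i) => k.
  rewrite (_ : _ \o _ = (fun x => tnth x k) \o fst).
    by apply: measurableT_comp => //; exact: measurable_tnth.
  by apply/funext => z /=; rewrite /cat_pair tnth_lshift.
rewrite (_ : _ \o _ = (fun x => tnth x k) \o snd).
  by apply: measurableT_comp => //; exact: measurable_tnth.
by apply/funext => z /=; rewrite /cat_pair tnth_rshift.
Qed.

HB.instance Definition _ := isMeasurableFun.Build _ _ _ _ cat_pair measurable_cat_pair.

Lemma measurable_reindex_tuple n (s : 'I_n -> 'I_m) : measurable_fun setT (@reindex_tuple T _ _ s).
Proof.
apply/measurable_fun_tnthP => i.
rewrite (_ : _ \o _ = (fun x => tnth x (s i))); first exact: measurable_tnth.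
by apply/funext => z /=; rewrite tnth_mktuple.
Qed.

End cat_tuple.

(** * Laws of blocks of an iid sequence *)

Section block.
Context (R : realType) d (Omega : measurableType d) (P : probability Omega R).
Context d' (T : measurableType d') (Z0 : {RV P >-> T}) (Z : nat -> {RV P >-> T}).

Definition block m (t : m.-tuple nat) (w : Omega) : m.-tuple T :=
  [tuple Z (tnth t k) w | k < m].

Lemma measurable_block m (t : m.-tuple nat) : measurable_fun setT (block t).
Proof.
apply/measurable_fun_tnthP => i.
rewrite (_ : _ \o _ = Z (tnth t i)); first exact: measurable_funP.
by apply/funext => z /=; rewrite tnth_mktuple.
Qed.

HB.instance Definition _ m (t : m.-tuple nat) :=
  isMeasurableFun.Build _ _ _ _ (block t) (measurable_block t).

Hypothesis iidZ : iid_copies Z0 Z.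

Lemma block_box m (t : m.-tuple nat) E : uniq t -> (forall k, measurable (E k)) ->
  distribution P (block t) (box E) = (\prod_(k < m) distribution P Z0 (E k))%E.
Proof.
(* Independence is stated for events indexed by all of nat: [E'] places [E k] at the k-th index of t
   and the full set off t. Distinctness of the indices makes it consistent. *)
move=> ut mE; pose E' i := if insub (index i t) is Some k then E k else setT.
have E'E k : E' (tnth t k) = E k.
  rewrite /E' (tnth_nth 0%N) index_uniq ?size_tuple //.
  by case: insubP => [k' _ kk'|]; [congr E; exact: val_inj|rewrite ltn_ord].
have mE' i : measurable (E' i) by rewrite /E'; case: insub.
have := iidZ.2 t E' ut mE'; rewrite big_tuple => e.
transitivity (\prod_(k < m) P (Z (tnth t k) @^-1` E' (tnth t k)))%E; last first.
  apply: eq_bigr => k _; rewrite E'E; exact: iidZ.1.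
rewrite -e; congr (P _); apply/seteqP; split=> [w Ew i /=|w Ew k].
  by move=> /tnthP[k ->]; rewrite E'E; have := Ew k; rewrite tnth_mktuple.
by rewrite tnth_mktuple -E'E; apply: Ew; exact: mem_tnth.
Qed.

Lemma block_law m (t t' : m.-tuple nat) : uniq t -> uniq t' ->
  forall B, measurable B -> distribution P (block t) B = distribution P (block t') B.
Proof.
move=> ut ut'; apply: eq_probability_boxes => E mE.
by apply: etrans (block_box ut mE) (esym _); exact: block_box.
Qed.

Lemma integral_block m (t t' : m.-tuple nat) (f : m.-tuple T -> \bar R) :
  uniq t -> uniq t' -> measurable_fun setT f ->
  (\int[P]_w f (block t w) = \int[P]_w f (block t' w))%E.
Proof.
move=> ut ut' mf; rewrite -!integral_distributionT //.
by apply: eq_measure_integral => B mB _; exact: block_law.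
Qed.

Lemma block_cat m p (t : m.-tuple nat) (t' : p.-tuple nat) w :
  block (cat_tuple t t') w = cat_tuple (block t w) (block t' w).
Proof.
apply: eq_from_tnth => i; rewrite tnth_mktuple -[i]splitK.
by case: (fintype.split i) => k; rewrite ?tnth_lshift ?tnth_rshift tnth_mktuple.
Qed.

(** The law of the concatenated block and the image of the product law under concatenation agree on
    boxes, hence everywhere. The splitting map [sp] inverts concatenation and transfers this to sets
    of pairs. *)
Lemma block_product_law m p (t : m.-tuple nat) (t' : p.-tuple nat) :
  uniq (t ++ t') -> product_law (block t : {RV P >-> _}) (block t' : {RV P >-> _}).
Proof.
move=> ut A mA.
have [u1 u2] : uniq t /\ uniq t' by move: ut; rewrite cat_uniq => /and3P[].
pose mu := (distribution P (block t) \x distribution P (block t'))%E.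
pose sp (z : (m + p).-tuple T) := (reindex_tuple (lshift p) z, reindex_tuple (@rshift m p) z).
have spK z : sp (cat_pair z) = z.
  by case: z => x y; congr pair; apply: eq_from_tnth => k;
    rewrite tnth_mktuple ?tnth_lshift ?tnth_rshift.
have msp : measurable_fun setT sp.
  by apply: measurable_fun_pair; exact: measurable_reindex_tuple.
have mB : measurable (sp @^-1` A) by rewrite -[X in measurable X]setTI; exact: msp.
have e : forall B, measurable B ->
    distribution P (block (cat_tuple t t')) B = distribution mu (@cat_pair _ T m p) B.
  apply: eq_probability_boxes => E mE.
  apply: (etrans (@block_box _ (cat_tuple t t') E ut mE)); rewrite big_split_ord /=.
  rewrite -(@block_box _ t (fun k => E (lshift p k))) //.
  rewrite -(@block_box _ t' (fun k => E (rshift m k))) //.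
  rewrite -product_measure1E //; [|exact: measurable_box|exact: measurable_box].
  congr (mu _); apply/seteqP; split=> [[x y] [/= Ex Ey] k|[x y] Exy].
    rewrite /cat_pair /= -[k]splitK; case: (fintype.split k) => k' /=.
      by rewrite tnth_lshift; exact: Ex.
    by rewrite tnth_rshift; exact: Ey.
  split=> k /=.
    by have := Exy (lshift p k); rewrite /cat_pair tnth_lshift.
  by have := Exy (rshift m k); rewrite /cat_pair tnth_rshift.
have := e _ mB; rewrite /distribution /pushforward.
have -> : @cat_pair _ T m p @^-1` (sp @^-1` A) = A.
  by apply/seteqP; split=> z; rewrite /preimage /= spK.
move=> <-; congr (P _); apply/seteqP; split=> w; rewrite /preimage /= block_cat.
  by rewrite -[cat_tuple _ _]/(cat_pair (block t w, block t' w)) spK.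
by rewrite -[cat_tuple _ _]/(cat_pair (block t w, block t' w)) spK.
Qed.

End block.

(** * Means of products of projections *)

Section has_mean.
Context (R : realType) d (Omega : measurableType d) (P : probability Omega R).
Implicit Types (f g : Omega -> R).

(** Integrability travels with the value, so that linearity can be used term by term in nested
    sums. *)
Definition has_mean f (m : R) : Prop :=
  P.-integrable setT (EFin \o f) /\ (\int[P]_w (f w)%:E)%E = m%:E.

Lemma has_mean_fine f : P.-integrable setT (EFin \o f) ->
  has_mean f (fine (\int[P]_w (f w)%:E)%E).
Proof. by move=> fi; split=> //; rewrite fineK //; exact: integrable_fin_num. Qed.

Lemma has_mean0 : has_mean (fun=> 0) 0.
Proof. by split; [exact: integrable0|rewrite integral0]. Qed.

Lemma has_meanD f g m m' : has_mean f m -> has_mean g m' ->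
  has_mean (fun w => f w + g w) (m + m').
Proof.
move=> [fi fm] [gi gm]; split; first exact: (integrableD measurableT fi gi).
by under eq_integral do rewrite EFinD; rewrite integralD // fm gm.
Qed.

Lemma has_meanZ f m c : has_mean f m -> has_mean (fun w => c * f w) (c * m).
Proof.
move=> [fi fm]; split; first exact: (integrableZl measurableT c fi).
by under eq_integral do rewrite EFinM; rewrite integralZl // fm.
Qed.

Lemma has_mean_sum (I : Type) (s : seq I) (Q : pred I) (f : I -> Omega -> R) (m : I -> R) :
  (forall i, Q i -> has_mean (f i) (m i)) ->
  has_mean (fun w => \sum_(i <- s | Q i) f i w) (\sum_(i <- s | Q i) m i).
Proof.
move=> fm; elim: s => [|i s IH].
  by rewrite big_nil; under eq_fun do rewrite big_nil; exact: has_mean0.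
rewrite big_cons; under eq_fun do rewrite big_cons.
by case: ifPn => // Qi; apply: has_meanD => //; exact: fm.
Qed.

Lemma has_mean_expectation f m : has_mean f m -> ('E_P[f] = m%:E)%E.
Proof. by case=> _ fm; rewrite unlock. Qed.

Lemma eq_has_mean f g m : f =1 g -> has_mean f m -> has_mean g m.
Proof. by move=> /funext->. Qed.

End has_mean.

Section fill.
Variables (r j : nat).

(* The arguments x_1, ..., x_j, v_{j+1}, ..., v_r of the integrand of hproj. *)
Definition fill (T : Type) (x : j.-tuple T) (v : r.-tuple T) : r.-tuple T :=
  [tuple nth (tnth v k) x k | k < r].

Lemma val_fill (T : Type) (x : j.-tuple T) (v : r.-tuple T) :
  (j <= r)%N -> fill x v = x ++ drop j v :> seq T.
Proof.
move=> jr; case: (posnP r) => [r0|r0].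
  by rewrite [LHS]size0nil ?[RHS]size0nil // ?size_cat ?size_drop ?size_tuple; lia.
pose x0 := tnth v (Ordinal r0).
apply: (@eq_from_nth _ x0); rewrite ?size_cat ?size_drop !size_tuple; first lia.
move=> k kr; rewrite -[k]/(val (Ordinal kr)) -tnth_nth tnth_mktuple nth_cat size_tuple /=.
case: ltnP => kj; first by apply: set_nth_default; rewrite size_tuple.
by rewrite nth_default ?size_tuple // nth_drop subnKC // (tnth_nth x0).
Qed.

Lemma measurable_fill d (T : measurableType d) :
  measurable_fun setT (fun z : j.-tuple T * r.-tuple T => fill z.1 z.2).
Proof.
apply/measurable_fun_tnthP => k; case: (ltnP k j) => kj.
  rewrite (_ : _ \o _ = (fun x => tnth x (Ordinal kj)) \o fst).
    by apply: measurableT_comp => //; exact: measurable_tnth.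
  by apply/funext => z /=; rewrite tnth_mktuple [RHS](tnth_nth (tnth z.2 k)).
rewrite (_ : _ \o _ = (fun x => tnth x k) \o snd).
  by apply: measurableT_comp => //; exact: measurable_tnth.
by apply/funext => z /=; rewrite tnth_mktuple nth_default // size_tuple.
Qed.

End fill.

Lemma subset_nat n l (S : ksubset n l) :
  [tuple val (subset_elt S k) | k < l] = map val (enum (val S)) :> seq nat.
Proof. by rewrite -map_subset_elt -map_comp. Qed.

Lemma count_subset_nat n l l' (S : ksubset n l) (S' : ksubset n l') :
  count (mem [tuple val (subset_elt S' k) | k < l']) [tuple val (subset_elt S k) | k < l]
  = #|val S :&: val S'|.
Proof.
rewrite subset_nat count_map -size_filter cardE; apply/perm_size/uniq_perm.
- by rewrite filter_uniq ?enum_uniq.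
- exact: enum_uniq.
move=> i; rewrite mem_filter !mem_enum finset.in_setI andbC; congr (_ && _).
have : (val i \in tval [tuple val (subset_elt S' k) | k < l']) = (i \in val S').
  by rewrite subset_nat (mem_map val_inj) mem_enum.
exact.
Qed.

(** * Kernels and projections evaluated on blocks of indices *)

Section kernel.
Context (R : realType) d (Omega : measurableType d) (P : probability Omega R).
Context d' (T : measurableType d') (Z0 : {RV P >-> T}) (Z : nat -> {RV P >-> T}).
Hypothesis iidZ : iid_copies Z0 Z.
Variable r : nat.
Let Zf (i : nat) (w : Omega) : T := Z i w.

Lemma block_fill j (s : j.-tuple nat) (q : r.-tuple nat) w :
  fill (block Z s w) (block Z q w) = block Z (fill s q) w.
Proof.
apply: eq_from_tnth => k; rewrite !tnth_mktuple.
case: (ltnP k j) => kj; last by rewrite !nth_default ?size_tuple.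
rewrite -(tnth_nth _ _ (Ordinal kj)) tnth_mktuple; congr (Z _ w).
by rewrite (tnth_nth (tnth q k)).
Qed.

Lemma block_reindex m n (u : m.-tuple nat) (s : 'I_n -> 'I_m) w :
  reindex_tuple s (block Z u w) = block Z (reindex_tuple s u) w.
Proof. by apply: eq_from_tnth => k; rewrite !tnth_mktuple. Qed.

Section one_kernel.
Variable A : r.-tuple T -> R.
Hypothesis A_meas : measurable_fun setT A.

(** [hproj] integrates over the first r sample points. Blocks of distinct indices have equal laws,
    so the integral may be taken over any such block q, in particular one disjoint from the
    arguments. *)
Lemma hproj_cond_mean m j (pr : m.-tuple T -> j.-tuple T) (q : r.-tuple nat) u :
  uniq q -> measurable_fun setT pr ->
  hproj P Zf A (pr u) = cond_mean (P := P) (block Z q) (fun z => A (fill (pr z.1) z.2)) u.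
Proof.
move=> uq mpr; rewrite /hproj /cond_mean unlock; congr fine.
pose f (v : r.-tuple T) := (A (fill (pr u) v))%:E.
transitivity (\int[P]_w f (block Z (iota_tuple r 0) w))%E.
  apply: eq_integral => w _; rewrite /f; congr (A _)%:E.
  apply: eq_from_tnth => k; rewrite !tnth_mktuple /Zf; congr nth.
  by rewrite (tnth_nth 0%N) /= nth_iota.
apply: (integral_block iidZ) => //; first exact: iota_uniq.
apply/measurable_EFinP; apply: measurableT_comp => //.
have := @measurable_fill r j _ T.
move/(fun H => measurableT_comp H
  (measurable_fun_pair (measurable_cst (pr u)) (@measurable_id _ _ _))).
exact.
Qed.

(** Inside a mean, the kernel with its missing arguments drawn from a fresh block can be replaced by
    its projection; f carries the other factor. *)
Lemma has_mean_hproj m j (u : m.-tuple nat) (q : r.-tuple nat)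
    (pr : m.-tuple T -> j.-tuple T) (f : m.-tuple T -> R) mu :
  uniq (u ++ q) -> measurable_fun setT pr -> measurable_fun setT f ->
  has_mean P (fun w => f (block Z u w) * A (fill (pr (block Z u w)) (block Z q w))) mu ->
  has_mean P (fun w => f (block Z u w) * hproj P Zf A (pr (block Z u w))) mu.
Proof.
move=> uuq mpr mf [fi fm].
have uq : uniq q by move: uuq; rewrite cat_uniq => /and3P[].
have mh : measurable_fun setT (fun z : m.-tuple T * r.-tuple T => A (fill (pr z.1) z.2)).
  apply: measurableT_comp => //.
  have mp : measurable_fun setT (fun z : m.-tuple T * r.-tuple T => (pr z.1, z.2)).
    by apply: measurable_fun_pair => //; exact: measurableT_comp.
  exact: (measurableT_comp (@measurable_fill r j _ T) mp).
have [gi gm] := integral_cond_mean (block_product_law iidZ uuq) mf mh fi.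
split.
  apply: eq_integrable gi => // w _ /=.
  by rewrite (hproj_cond_mean _ uq mpr).
rewrite -fm -gm; apply: eq_integral => w _.
by rewrite (hproj_cond_mean _ uq mpr).
Qed.

Lemma measurable_hproj j : measurable_fun setT (hproj P Zf A (j := j)).
Proof.
have -> : hproj P Zf A (j := j) =
    cond_mean (P := P) (block Z (iota_tuple r 0)) (fun z => A (fill z.1 z.2)).
  apply/funext => x; apply: (@hproj_cond_mean j j id) => //; exact: iota_uniq.
apply: measurable_cond_mean; apply: measurableT_comp => //; exact: measurable_fill.
Qed.

Hypothesis A_sym : sym_kernel A.

Lemma kernel_block_perm (t t' : r.-tuple nat) w : perm_eq t t' ->
  A (block Z t w) = A (block Z t' w).
Proof.
move=> /tuple_permP[p tE]; rewrite -[RHS](A_sym p); congr A.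
apply: eq_from_tnth => k; rewrite !tnth_mktuple; congr (Z _ w).
have -> : t = [tuple tnth t' (p i) | i < r] by apply: val_inj.
by rewrite tnth_mktuple.
Qed.

Hypothesis A_L2 : P.-integrable setT (fun w => (A (block Z (iota_tuple r 0) w) ^+ 2)%:E).

Lemma kernel_block_L2 (t : r.-tuple nat) : uniq t ->
  P.-integrable setT (fun w => (A (block Z t w) ^+ 2)%:E).
Proof.
move=> ut; pose f (x : r.-tuple T) := `|(A x ^+ 2)%:E|%E.
have mA2 : measurable_fun setT (fun x => (A x ^+ 2)%:E).
  by apply/measurable_EFinP; apply: measurable_funX.
apply/integrableP; split; first exact: (measurableT_comp mA2 (measurable_block Z t)).
rewrite -[X in (X < _)%E]/(\int[P]_w f (block Z t w))%E.
rewrite (integral_block iidZ (t' := iota_tuple r 0)) ?iota_uniq //.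
  by case/integrableP: A_L2.
exact: measurableT_comp.
Qed.

End one_kernel.

Section two_kernels.
Variables A B : r.-tuple T -> R.
Hypotheses (A_meas : measurable_fun setT A) (B_meas : measurable_fun setT B).
Hypotheses (A_sym : sym_kernel A) (B_sym : sym_kernel B).
Hypothesis A_L2 : P.-integrable setT (fun w => (A (block Z (iota_tuple r 0) w) ^+ 2)%:E).
Hypothesis B_L2 : P.-integrable setT (fun w => (B (block Z (iota_tuple r 0) w) ^+ 2)%:E).

Lemma integrable_block_mul (t t' : r.-tuple nat) : uniq t -> uniq t' ->
  P.-integrable setT (EFin \o (fun w => A (block Z t w) * B (block Z t' w))).
Proof.
move=> ut ut'.
have iA := kernel_block_L2 A_meas A_L2 ut; have iB := kernel_block_L2 B_meas B_L2 ut'.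
apply: (le_integrable measurableT _ _ (integrableD measurableT iA iB)).
  apply/measurable_EFinP; apply: measurable_funM.
    exact: (measurableT_comp A_meas (measurable_block Z t)).
  exact: (measurableT_comp B_meas (measurable_block Z t')).
move=> w _ /=; rewrite lee_fin; move: (A _) (B _) => x y.
rewrite normrM [leRHS]ger0_norm ?addr_ge0 ?sqr_ge0 //.
rewrite -(real_normK (num_real x)) -(real_normK (num_real y)).
move: `|x| `|y| (normr_ge0 x) (normr_ge0 y) => {}x {}y x0 y0; nra.
Qed.

(** A canonical pair of overlap s, for s <= r: A reads the first r coordinates and B the last r, so
    they share the s in the middle. *)
Definition overlap_kernel s (z : (r + (r - s))%N.-tuple T) : R :=
  A (reindex_tuple (lshift (r - s)%N) z) *
  B (reindex_tuple (cast_ord (addnC (r - s)%N r) \o @rshift (r - s)%N r) z).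

Definition overlap_mean s : R :=
  fine (\int[P]_w (overlap_kernel (block Z (iota_tuple (r + (r - s))%N 0) w))%:E)%E.

Lemma measurable_overlap_kernel s : measurable_fun setT (@overlap_kernel s).
Proof.
by apply: measurable_funM; apply: measurableT_comp => //; exact: measurable_reindex_tuple.
Qed.

(** By symmetry of the kernels, the common indices C can be moved to the end of t and to the start
    of t'. Both then sit in the single block [D ++ C ++ D'] of distinct indices, whose law depends
    only on its length. *)
Lemma has_mean_overlap (t t' : r.-tuple nat) : uniq t -> uniq t' ->
  has_mean P (fun w => A (block Z t w) * B (block Z t' w)) (overlap_mean (count (mem t') t)).
Proof.
move=> ut ut'; set s := count _ _.
pose C := seq.filter (mem t') t; pose D := seq.filter (predC (mem t')) t.
pose D' := seq.filter (predC (mem t)) t'.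
have CE : perm_eq C (seq.filter (mem t) t').
  by apply: uniq_perm; rewrite ?filter_uniq // => i; rewrite !mem_filter andbC.
have pt : perm_eq t (D ++ C) by rewrite perm_sym perm_catC; apply/permPl/perm_filterC.
have pt' : perm_eq t' (C ++ D').
  rewrite perm_sym; apply: seq.perm_trans (_ : perm_eq (seq.filter (mem t) t' ++ D') t').
    by rewrite perm_cat2r.
  exact/permPl/perm_filterC.
have sC : size C = s by rewrite size_filter.
have := perm_size pt; have := perm_size pt'; rewrite !size_cat !size_tuple sC => sD' sD.
have sp : size (D ++ C ++ D') == (r + (r - s))%N by rewrite !size_cat sC; apply/eqP; lia.
pose p := Tuple sp.
have up : uniq p.
  rewrite /= !cat_uniq !filter_uniq //= andbT; apply/andP; split=> //.
    apply/hasPn => i; rewrite mem_cat !mem_filter /= => /orP[/andP[-> _]//|].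
    by move=> /andP[it it']; rewrite (negPf it) andbF.
  by apply/hasPn => i; rewrite !mem_filter /= => /andP[it _]; rewrite (negPf it) andbF.
have e1 : reindex_tuple (lshift (r - s)%N) p = D ++ C :> seq nat.
  apply: (@eq_from_nth _ 0%N) => [|i]; rewrite size_tuple ?size_cat ?sC // => ir.
  rewrite -[i]/(val (Ordinal ir)) -tnth_nth tnth_mktuple (tnth_nth 0%N) /=.
  by rewrite catA [LHS]nth_cat size_cat sC -sD ir.
have e2 : reindex_tuple (cast_ord (addnC (r - s)%N r) \o @rshift (r - s)%N r) p =
    C ++ D' :> seq nat.
  apply: (@eq_from_nth _ 0%N) => [|i]; rewrite size_tuple ?size_cat ?sC // => ir.
  rewrite -[i]/(val (Ordinal ir)) -tnth_nth tnth_mktuple (tnth_nth 0%N) /=.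
  by rewrite nth_cat (_ : size D = (r - s)%N); [rewrite ltnNge leq_addr /= addKn|lia].
have E w : A (block Z t w) * B (block Z t' w) = overlap_kernel (block Z p w).
  rewrite /overlap_kernel !block_reindex; congr (_ * _); apply: kernel_block_perm => //.
    by rewrite e1.
  by rewrite e2.
have [i m] := has_mean_fine (integrable_block_mul ut ut').
split=> //; rewrite m; congr (fine _)%:E.
under eq_integral do rewrite E.
apply: (integral_block iidZ (f := EFin \o @overlap_kernel s)) => //; first exact: iota_uniq.
by apply/measurable_EFinP; exact: measurable_overlap_kernel.
Qed.

Lemma has_mean_hproj2 (l l' : nat) (S : ksubset r l) (S' : ksubset r l') :
  has_mean P (fun w =>
      hproj P Zf A (reindex_tuple (subset_elt S) (block Z (iota_tuple r 0) w)) *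
      hproj P Zf B (reindex_tuple (subset_elt S') (block Z (iota_tuple r 0) w)))
    (overlap_mean #|val S :&: val S'|).
Proof.
have lr : (l <= r)%N by rewrite -[l](eqP (valP S)) -[leqRHS]card_ord max_card.
have lr' : (l' <= r)%N by rewrite -[l'](eqP (valP S')) -[leqRHS]card_ord max_card.
(* Three disjoint blocks of indices: the arguments of both projections, and one
   fresh block for each of the two conditional expectations. *)
pose u0 := iota_tuple r 0; pose q1 := iota_tuple r r; pose q2 := iota_tuple r (r + r)%N.
pose s := reindex_tuple (subset_elt S) u0; pose s' := reindex_tuple (subset_elt S') u0.
pose t := fill s q1; pose t' := fill s' q2.
have sE n (U : ksubset r n) :
    reindex_tuple (subset_elt U) u0 = [tuple val (subset_elt U k) | k < n].
  by apply: eq_from_tnth => k; rewrite !tnth_mktuple (tnth_nth 0%N) /= nth_iota.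
have sP n (U : ksubset r n) i : i \in reindex_tuple (subset_elt U) u0 -> (i < r)%N.
  by rewrite sE => /mapP[k _ ->]; exact: ltn_ord.
have us n (U : ksubset r n) : uniq (reindex_tuple (subset_elt U) u0).
  by rewrite sE subset_nat map_inj_uniq ?enum_uniq //; exact: val_inj.
have q1P j i : i \in drop j q1 -> (r <= i < r + r)%N.
  by move=> /mem_drop; rewrite mem_iota.
have q2P j i : i \in drop j q2 -> (r + r <= i)%N.
  by move=> /mem_drop; rewrite mem_iota => /andP[].
have ut : uniq t.
  rewrite val_fill // cat_uniq us drop_uniq ?iota_uniq // andbT /=.
  by apply/hasPn => i /q1P ri; apply/negP => /sP; lia.
have ut' : uniq t'.
  rewrite val_fill // cat_uniq us drop_uniq ?iota_uniq // andbT /=.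
  by apply/hasPn => i /q2P ri; apply/negP => /sP; lia.
have memt' i : (i \in tval t') = (i \in tval s') || (i \in drop l' q2).
  by rewrite val_fill // mem_cat.
(* The fresh tails of t and t' meet neither each other nor the arguments, so common indices come
   from [S :&: S'] alone. *)
have ov : count (mem t') t = #|val S :&: val S'|.
  rewrite -count_subset_nat -!sE [in LHS]val_fill // count_cat [X in (_ + X)%N](_ : _ = 0%N).
    rewrite addn0; apply: eq_in_count => i /sP ir; rewrite -[LHS]/(i \in tval t') memt'.
    by case: (boolP (i \in drop _ _)) => [/q2P|_]; [lia|rewrite orbF].
  apply/eqP; rewrite -leqn0 leqNgt -has_count; apply/hasPn => i /q1P ir.
  by rewrite -[mem _ _]/(i \in tval t') memt'; apply/negP => /orP[/sP|/q2P]; lia.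
have := has_mean_overlap ut ut'; rewrite ov => m0.
have uu2 : uniq (u0 ++ q2).
  rewrite cat_uniq !iota_uniq andbT; apply/hasPn => i.
  by rewrite -[X in ~~ X]/(i \in iota 0 r) !mem_iota; lia.
have uu : uniq (cat_tuple u0 q2 ++ q1).
  rewrite cat_uniq uu2 iota_uniq andbT; apply/hasPn => i.
  by rewrite -[X in ~~ X]/(i \in iota 0 r ++ iota (r + r) r) mem_cat !mem_iota; lia.
have catE n (U : ksubset r n) w :
    reindex_tuple (lshift r \o subset_elt U) (block Z (cat_tuple u0 q2) w) =
    block Z (reindex_tuple (subset_elt U) u0) w.
  rewrite block_reindex; congr (block Z _ w); apply: eq_from_tnth => k.
  by rewrite !tnth_mktuple tnth_lshift.
have catE2 w : reindex_tuple (@rshift r r) (block Z (cat_tuple u0 q2) w) = block Z q2 w.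
  rewrite block_reindex; congr (block Z _ w); apply: eq_from_tnth => k.
  by rewrite !tnth_mktuple tnth_rshift.
(* The unprojected factor B is a function of the enlarged block of u0 and q2. This lets q1 be
   integrated out first, turning A into its projection; q2 follows and does the same for B. *)
pose f1 (z : (r + r).-tuple T) :=
  B (fill (reindex_tuple (lshift r \o subset_elt S') z) (reindex_tuple (@rshift r r) z)).
have mf1 : measurable_fun setT f1.
  apply: measurableT_comp => //.
  have mp : measurable_fun setT (fun z : (r + r).-tuple T =>
      (reindex_tuple (lshift r \o subset_elt S') z, reindex_tuple (@rshift r r) z)).
    by apply: measurable_fun_pair; exact: measurable_reindex_tuple.
  exact: (measurableT_comp (@measurable_fill r l' _ T) mp).
have m1 : has_mean P (fun w => f1 (block Z (cat_tuple u0 q2) w) * hproj P Zf A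
    (reindex_tuple (lshift r \o subset_elt S) (block Z (cat_tuple u0 q2) w)))
    (overlap_mean #|val S :&: val S'|).
  apply: (has_mean_hproj (q := q1) A_meas uu _ mf1); first exact: measurable_reindex_tuple.
  apply: eq_has_mean m0 => w.
  by rewrite /f1 !catE catE2 !block_fill mulrC.
apply: (has_mean_hproj (q := q2) (f := fun z => hproj P Zf A (reindex_tuple (subset_elt S) z))
  (pr := reindex_tuple (subset_elt S')) B_meas uu2).
- exact: measurable_reindex_tuple.
- by apply: measurableT_comp; [exact: measurable_hproj|exact: measurable_reindex_tuple].
apply: eq_has_mean m1 => w.
by rewrite /f1 !catE catE2 mulrC !block_reindex.
Qed.

End two_kernels.
End kernel.

(** * Means of the estimator and of the product of Hoeffding components *)

Section expectations.
Context (R : realType) d (Omega : measurableType d) (P : probability Omega R).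
Context d' (T : measurableType d') (Z0 : {RV P >-> T}) (Z : nat -> {RV P >-> T}).
Hypothesis iidZ : iid_copies Z0 Z.
Variables (r : nat) (A B : r.-tuple T -> R).
Hypotheses (A_meas : measurable_fun setT A) (B_meas : measurable_fun setT B).
Hypotheses (A_sym : sym_kernel A) (B_sym : sym_kernel B).
Hypothesis A_L2 : P.-integrable setT (fun w => (A (block Z (iota_tuple r 0) w) ^+ 2)%:E).
Hypothesis B_L2 : P.-integrable setT (fun w => (B (block Z (iota_tuple r 0) w) ^+ 2)%:E).

Let Zf (i : nat) (w : Omega) : T := Z i w.
Let eta := overlap_mean Z A B.

Definition direct_mean : R := \sum_(s < r.+1) (-1) ^+ (r - s) * 'C(r, s)%:R * eta s.

Lemma has_mean_Tdir n : (2 * r <= n)%N ->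
  has_mean P (fun w => Tdir (kernel_array A (fun i : 'I_n => Zf i w))
                            (kernel_array B (fun i : 'I_n => Zf i w))) direct_mean.
Proof.
move=> n2r; rewrite /direct_mean -(sum_inter _ n2r).
apply: has_mean_sum => s _; apply: has_meanZ; apply: has_meanZ.
apply: has_mean_sum => I _; apply: has_mean_sum => J /eqP IJ.
have ut (K : ksubset n r) : uniq [tuple val (subset_elt K k) | k < r].
  by rewrite subset_nat map_inj_uniq ?enum_uniq //; exact: val_inj.
have := has_mean_overlap iidZ A_meas B_meas A_sym B_sym A_L2 B_L2 (ut I) (ut J).
rewrite count_subset_nat IJ; apply: eq_has_mean => w; rewrite !ffunE.
by congr (A _ * B _); apply: eq_from_tnth => k; rewrite !tnth_mktuple.
Qed.

(** Both components expand into signed projections by [moebius_subtuple]. Linearity leaves the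
    double sum of [sum_sign_inter], here graded by subset size to match the expansions. *)
Lemma has_mean_hcomp2 :
  has_mean P (fun w => hcomp P Zf A (block Z (iota_tuple r 0) w) *
                       hcomp P Zf B (block Z (iota_tuple r 0) w)) direct_mean.
Proof.
pose u := iota_tuple r 0.
pose t := (fun l S l' S' => (-1) ^+ (r - l) * ((-1) ^+ (r - l') * eta #|S :&: S'|))
  : nat -> {set 'I_r} -> nat -> {set 'I_r} -> R.
have -> : direct_mean = \sum_(l < r.+1) \sum_(S : ksubset r l)
    \sum_(l' < r.+1) \sum_(S' : ksubset r l') t l (val S) l' (val S').
  rewrite /direct_mean -sum_sign_inter.
  have sumT (F : nat -> {set 'I_r} -> R) :
      \sum_(S : {set 'I_r}) F #|S| S = \sum_(l < r.+1) \sum_(S : ksubset r l) F l (val S).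
    transitivity (\sum_(S : {set 'I_r} | S \subset finset.setT) F #|S| S).
      by apply: eq_bigl => S; rewrite finset.subsetT.
    rewrite -(sum_card (r := r)) ?cardsT ?card_ord //; apply: eq_bigr => l _.
    by apply: eq_bigl => S; rewrite finset.subsetT.
  rewrite (sumT (fun l S => \sum_(S' : {set 'I_r}) t l S #|S'| S')).
  by apply: eq_bigr => l _; apply: eq_bigr => S _; rewrite (sumT (t l (val S))).
have hE C w : hcomp P Zf C (block Z u w) = \sum_(l < r.+1) \sum_(S : ksubset r l)
    (-1) ^+ (r - l) * hproj P Zf C (reindex_tuple (subset_elt S) (block Z u w)).
  exact: (moebius_subtuple (hcompE P Zf C)).
under eq_fun do rewrite !hE mulr_suml.
apply: has_mean_sum => l _; under eq_fun do rewrite mulr_suml.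
apply: has_mean_sum => S _; under eq_fun do rewrite mulr_sumr.
apply: has_mean_sum => l' _; under eq_fun do rewrite mulr_sumr.
apply: has_mean_sum => S' _.
under eq_fun do rewrite -mulrA [X in _ * X]mulrCA.
do 2 apply: has_meanZ.
exact (has_mean_hproj2 iidZ A_meas B_meas A_sym B_sym A_L2 B_L2 S S').
Qed.

End expectations.

(* Kernels on either coordinate of a pair are kernels on the pair, so that the
   joint sample can be treated as a single iid sequence. *)
Section push_kernel.
Context (R : realType) d (Omega : measurableType d) (P : probability Omega R).
Context d1 (T : measurableType d1) d2 (TX : measurableType d2).
Context (Z : nat -> {RV P >-> T}).
Variables (p : T -> TX) (r : nat) (a : r.-tuple TX -> R).
Let Zf (i : nat) (w : Omega) : T := Z i w.
Let X (i : nat) (w : Omega) : TX := p (Z i w).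

Definition push_kernel (z : r.-tuple T) : R := a (map_tuple p z).

Lemma sym_push_kernel : sym_kernel a -> sym_kernel push_kernel.
Proof.
move=> a_sym s z; rewrite /push_kernel -[RHS](a_sym s); congr a.
by apply: eq_from_tnth => k; rewrite tnth_map !tnth_mktuple tnth_map.
Qed.

Lemma measurable_push_kernel : measurable_fun setT p -> measurable_fun setT a ->
  measurable_fun setT push_kernel.
Proof.
move=> mp ma; apply: measurableT_comp => //; apply/measurable_fun_tnthP => k.
rewrite (_ : _ \o _ = p \o (fun z => tnth z k)).
  by apply: measurableT_comp => //; exact: measurable_tnth.
by apply/funext => z /=; rewrite tnth_map.
Qed.

Lemma push_kernel_block w : push_kernel (block Z (iota_tuple r 0) w) = a [tuple X i w | i < r].
Proof.
congr a; apply: eq_from_tnth => k; rewrite tnth_map !tnth_mktuple.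
by rewrite (tnth_nth 0%N) nth_iota.
Qed.

Lemma push_kernel_array n w :
  kernel_array a (fun i : 'I_n => X i w) = kernel_array push_kernel (fun i : 'I_n => Zf i w).
Proof.
apply/ffunP => I; rewrite !ffunE; congr a.
by apply: eq_from_tnth => k; rewrite [RHS]tnth_map !tnth_mktuple.
Qed.

Lemma hproj_push_kernel j (z : j.-tuple T) :
  hproj P X a (map_tuple p z) = hproj P Zf push_kernel z.
Proof.
rewrite /hproj; congr (fine 'E_P[_]); apply/funext => w; congr a.
apply: eq_from_tnth => k; rewrite [RHS]tnth_map !tnth_mktuple.
case: (ltnP k j) => kj; last by rewrite !nth_default ?size_tuple.
by rewrite (nth_map (Z k w)) ?size_tuple.
Qed.

(** The signed expansion of components reduces the claim to projections, so no further induction on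
    the recursion is made. *)
Lemma hcomp_push_kernel j (z : j.-tuple T) :
  hcomp P X a (map_tuple p z) = hcomp P Zf push_kernel z.
Proof.
rewrite (moebius_subtuple (hcompE P X a)) (moebius_subtuple (hcompE P Zf push_kernel)).
apply: eq_bigr => l _; apply: eq_bigr => S _; congr (_ * _).
rewrite -hproj_push_kernel; congr hproj.
by apply: eq_from_tnth => k; rewrite [RHS]tnth_map !tnth_mktuple tnth_map.
Qed.

Lemma integrable_push_kernel :
  measurable_fun setT p -> measurable_fun setT a ->
  ('E_P[fun w => (a [tuple X i w | i < r] ^+ 2)%R] < +oo)%E ->
  P.-integrable setT (fun w => (push_kernel (block Z (iota_tuple r 0) w) ^+ 2)%:E).
Proof.
move=> mp ma; rewrite unlock => L2.
apply/integrableP; split.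
  apply/measurable_EFinP; apply: measurable_funX.
  exact: (measurableT_comp (measurable_push_kernel mp ma) (measurable_block Z _)).
apply: le_lt_trans L2; rewrite le_eqVlt; apply/orP; left; apply/eqP.
apply: eq_integral => w _.
by rewrite push_kernel_block gee0_abs // lee_fin sqr_ge0.
Qed.

End push_kernel.

(** * Identities for the direct overlap estimator and its unbiasedness *)

Theorem theorem6p4 (R : realType) (d dX dY : measure_display)
    (Omega : measurableType d) (TX : measurableType dX) (TY : measurableType dY)
    (P : probability Omega R)
    (XY : {RV P >-> (TX * TY)%type}) (O_ : nat -> {RV P >-> (TX * TY)%type})
    (Oiid : iid_copies XY O_)
    (X := fun (i : nat) (w : Omega) => (O_ i w).1)
    (Y := fun (i : nat) (w : Omega) => (O_ i w).2)
    (n r : nat) (r_ge1 : (1 <= r)%N) (n_ge2r : (2 * r <= n)%N)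
    (a : r.-tuple TX -> R) (b : r.-tuple TY -> R)
    (a_meas : measurable_fun [set: r.-tuple TX] a)
    (b_meas : measurable_fun [set: r.-tuple TY] b)
    (a_sym : sym_kernel a) (b_sym : sym_kernel b)
    (a_L2 : ('E_P[fun w => (a [tuple X i w | i < r] ^+ 2)%R] < +oo)%E)
    (b_L2 : ('E_P[fun w => (b [tuple Y i w | i < r] ^+ 2)%R] < +oo)%E)
    (A := fun w : Omega => kernel_array a (fun i : 'I_n => X i w))
    (B := fun w : Omega => kernel_array b (fun i : 'I_n => Y i w)) :
  (forall w : Omega,
     [/\ Tdir (A w) (B w) =
           1 / dimU R n r * inner (ucenter (A w)) (ucenter (B w)),
         1 / dimU R n r * inner (ucenter (A w)) (ucenter (B w)) =
           1 / dimU R n r * inner (A w) (ucenter (B w))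
       & 1 / dimU R n r * inner (A w) (ucenter (B w)) =
           1 / dimU R n r * inner (ucenter (A w)) (B w)])
  /\ (Theta P X Y a b \is a fin_num
      /\ ('E_P[fun w =>
              (1 / dimU R n r * inner (ucenter (A w)) (ucenter (B w)))%R])%E
         = Theta P X Y a b).
Proof.
have innerE w : inner (ucenter (A w)) (ucenter (B w)) = inner (A w) (ucenter (B w)).
  by rewrite inner_ucenter // inner_ucenterC.
split=> [w|].
  by rewrite innerE -inner_ucenterC; split=> //; exact: Tdir_inner.
pose a' := push_kernel (fst : TX * TY -> TX) a.
pose b' := push_kernel (snd : TX * TY -> TY) b.
have ma' : measurable_fun setT a' by exact: measurable_push_kernel.
have mb' : measurable_fun setT b' by exact: measurable_push_kernel.
have La' := integrable_push_kernel (Z := O_) measurable_fst a_meas a_L2.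
have Lb' := integrable_push_kernel (Z := O_) measurable_snd b_meas b_L2.
have sa' := sym_push_kernel (fst : TX * TY -> TX) a_sym.
have sb' := sym_push_kernel (snd : TX * TY -> TY) b_sym.
have mT := has_mean_Tdir Oiid ma' mb' sa' sb' La' Lb' n_ge2r.
have mH := has_mean_hcomp2 Oiid ma' mb' sa' sb' La' Lb'.
(* The components of a and b are those of the pushed kernels on the joint sample, so the target is
   the real number [direct_mean]; this also gives its finiteness. *)
have ThetaE : Theta P X Y a b = (direct_mean O_ a' b')%:E.
  rewrite -(has_mean_expectation mH) /Theta; congr ('E_P[_])%E; apply/funext => w.
  rewrite /a' /b' -!hcomp_push_kernel; congr (_ * _); congr hcomp.
    by apply: eq_from_tnth => k; rewrite [RHS]tnth_map !tnth_mktuple (tnth_nth 0%N) nth_iota.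
  by apply: eq_from_tnth => k; rewrite [RHS]tnth_map !tnth_mktuple (tnth_nth 0%N) nth_iota.
split; first by rewrite ThetaE.
rewrite ThetaE -(has_mean_expectation mT); congr ('E_P[_])%E; apply/funext => w.
rewrite innerE -Tdir_inner // /A /B; congr Tdir; exact: push_kernel_array.
Qed.
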